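(* Let $n\ge 1$. There is a $\mathbb{Z}$-algebra isomorphism $${}^{\mathfrak b}\mathsf{NH}_n^{ext}\xrightarrow{\ \sim\ }\operatorname{End}_{{}^{\mathfrak b}\Lambda_n^{ext}}(\mathsf{P}_n^{ext})\cong\operatorname{Mat}_{P_{B_n}(q)}({}^{\mathfrak b}\Lambda_n^{ext}),$$ where the first map is given by the action of ${}^{\mathfrak b}\mathsf{NH}_n^{ext}$ on $\mathsf{P}_n^{ext}$, and $P_{B_n}(q)=\prod_{i=1}^n(1+q+q^2+\cdots+q^{2i-1})$.
   Context: $\mathsf{P}_n^{ext}=\mathbb{Q}[x_1,\dots,x_n]\otimes\bigwedge[\omega_1,\dots,\omega_n]$ (exterior algebra over $\mathbb{Q}$; the $x_i$ commute with the $\omega_j$), graded by $\deg(x_i)=1$, $\deg(\omega_i)=-2i$, with the $\omega_i$ odd and the $x_i$ even. The Weyl group $W_{B_n}$ with simple reflections $s_1,\dots,s_n$ acts by algebra automorphisms: for $i<n$, $s_i(x_j)=x_{s_i(j)}$ and $s_i(\omega_j)=\omega_j+\delta_{ij}(x_i^2-x_{i+1}^2)\omega_{i+1}$; and $s_n(x_j)=x_j$ for $j<n$, $s_n(x_n)=-x_n$, $s_n(\omega_j)=\omega_j$ for all $j$. The Demazure operators are $\partial_i=\frac{\mathbf 1-s_i}{x_i-s_i(x_i)}$, $1\le i\le n$, of degree $-1$ and even. ${}^{\mathfrak b}\mathsf{NH}_n^{ext}$ is the $\mathbb{Q}$-superalgebra of operators on $\mathsf{P}_n^{ext}$ generated by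 multiplication by elements of $\mathsf{P}_n^{ext}$ and the Demazure operators $\partial_1,\dots,\partial_n$. The ring of extended symmetric polynomials is ${}^{\mathfrak b}\Lambda_n^{ext}=\bigcap_{i=1}^n\ker(\partial_i)\subset\mathsf{P}_n^{ext}$. $\operatorname{End}_{{}^{\mathfrak b}\Lambda_n^{ext}}(\mathsf{P}_n^{ext})$ denotes endomorphisms of $\mathsf{P}_n^{ext}$ as a supermodule over the supercommutative ring ${}^{\mathfrak b}\Lambda_n^{ext}$, i.e. sums of homogeneous maps $f$ with $f(\lambda m)=(-1)^{|f||\lambda|}\lambda f(m)$ (equivalently, maps commuting with right multiplication by ${}^{\mathfrak b}\Lambda_n^{ext}$). For $P(q)=\sum_k q^{a_k}$, $\operatorname{Mat}_{P(q)}(R)$ denotes the algebra of matrices over the graded ring $R$ of size $P(1)\times P(1)$, graded as the endomorphism algebra of a free graded $R$-module with (even) basis elements in degrees $a_k$, i.e. of graded rank $P(q)$. *)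

(* Defs.v *)
From HB Require Import structures.
From mathcomp Require Import all_boot all_order all_algebra.
From mathcomp Require Import fingroup perm boolp.
From mathcomp Require Import mpoly.
From mathcomp Require Import ring.

Set Implicit Arguments.
Unset Strict Implicit.
Unset Printing Implicit Defensive.

Import Order.TTheory GRing.Theory Num.Theory.
Local Open Scope ring_scope.

(* All indices are shifted down by one: i : 'I_n stands for the index i+1 of x_1..x_n, omega_1..omega_n, s_1..s_n.
   For S = {s_1 < ... < s_k} put omega_S = omega_{s_1} ... omega_{s_k}; then
   omega_S omega_T = wedge_sign S T omega_(S u T). *)
Definition inversions n (S T : {set 'I_n}) : nat :=
  (\sum_(s in S) \sum_(t in T) (t < s))%N.

Definition wedge_sign n (S T : {set 'I_n}) : {mpoly rat[n]} :=
  if [disjoint S & T] then (-1) ^+ inversions S T else 0.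

Section Sign.
Variable n : nat.
Implicit Types S T V : {set 'I_n}.

Lemma wedge_sign0l T : wedge_sign set0 T = 1.
Proof.
by rewrite /wedge_sign -setI_eq0 set0I eqxx /inversions big_set0 expr0.
Qed.

Lemma wedge_sign0r S : wedge_sign S set0 = 1.
Proof.
rewrite /wedge_sign -setI_eq0 setI0 eqxx /inversions big1 ?expr0 // => s _.
by rewrite big_set0.
Qed.

Lemma sum_disjointU S T (F : 'I_n -> nat) : [disjoint S & T] ->
  (\sum_(i in S :|: T) F i = \sum_(i in S) F i + \sum_(i in T) F i)%N.
Proof.
by move=> dST; rewrite -bigU //; apply: eq_bigl => i; rewrite !inE.
Qed.

Lemma inversionsUl S T V : [disjoint S & T] ->
  inversions (S :|: T) V = (inversions S V + inversions T V)%N.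
Proof. by move=> dST; rewrite /inversions sum_disjointU. Qed.

Lemma inversionsUr S T V : [disjoint T & V] ->
  inversions S (T :|: V) = (inversions S T + inversions S V)%N.
Proof.
move=> dTV; rewrite /inversions -big_split /=.
by apply: eq_bigr => s _; rewrite sum_disjointU.
Qed.

Lemma disjointUr S T V :
  [disjoint S & T :|: V] = [disjoint S & T] && [disjoint S & V].
Proof. by rewrite -!setI_eq0 setIUr setU_eq0. Qed.

Lemma disjointUl S T V :
  [disjoint S :|: T & V] = [disjoint S & V] && [disjoint T & V].
Proof. by rewrite -!setI_eq0 setIUl setU_eq0. Qed.

Lemma wedge_sign_cocycle S T V :
  wedge_sign S T * wedge_sign (S :|: T) V =
  wedge_sign T V * wedge_sign S (T :|: V).
Proof.
rewrite /wedge_sign disjointUl disjointUr.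
case dST: [disjoint S & T]; case dSV: [disjoint S & V];
  case dTV: [disjoint T & V]; rewrite /= ?(mul0r, mulr0) //.
by rewrite inversionsUl // inversionsUr // -!exprD addnA addnC addnA.
Qed.

End Sign.

(* Q[x_1..x_n] (x) /\[omega_1..omega_n]: p S is the coefficient of omega_S. *)
Definition Pext (n : nat) : Type := {ffun {set 'I_n} -> {mpoly rat[n]}}.

HB.lock Definition pext_mul n (p q : Pext n) : Pext n :=
  [ffun U => \sum_S \sum_(T | S :|: T == U) wedge_sign S T * (p S * q T)].

Section PextRing.
Variable n : nat.
Implicit Types (S T U V : {set 'I_n}) (p q r : Pext n).

HB.instance Definition _ := GRing.Lmodule.copy (Pext n)
  {ffun {set 'I_n} -> {mpoly rat[n]}}.

Definition pext_one : Pext n := [ffun S => (S == set0)%:R].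

Lemma pext_mulE0 p q U : pext_mul p q U =
  \sum_S \sum_(T | S :|: T == U) wedge_sign S T * (p S * q T).
Proof. by rewrite unlock ffunE. Qed.

Lemma pext_addE p q S : (p + q : Pext n) S = p S + q S.
Proof. by rewrite ffunE. Qed.

Lemma pext_mulA : associative (@pext_mul n).
Proof.
move=> p q r; apply/ffunP => U; rewrite !pext_mulE0.
transitivity (\sum_S \sum_T \sum_(V | S :|: (T :|: V) == U)
   wedge_sign S (T :|: V) * wedge_sign T V * (p S * q T * r V)).
  apply: eq_bigr => S _.
  under eq_bigr => W _.
    rewrite pext_mulE0 2!mulr_sumr.
    under eq_bigr do rewrite 2!mulr_sumr.
    over.
  rewrite exchange_big /=; apply: eq_bigr => T _.
  rewrite (exchange_big_dep predT) //= [RHS]big_mkcond; apply: eq_bigr => V _.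
  rewrite (eq_bigl (fun W => (W == T :|: V) && (S :|: (T :|: V) == U))); last first.
    by move=> W; rewrite andbC; case: eqVneq => //= ->.
  case: eqVneq => _; last by rewrite big_pred0 // => W; rewrite andbF.
  by under eq_bigl do rewrite andbT; rewrite big_pred1_eq; ring.
transitivity (\sum_S \sum_T \sum_(V | (S :|: T) :|: V == U)
   wedge_sign (S :|: T) V * wedge_sign S T * (p S * q T * r V)).
  apply: eq_bigr => S _; apply: eq_bigr => T _.
  under [RHS]eq_bigl do rewrite -setUA.
  apply: eq_bigr => V _.
  by rewrite [in RHS]mulrC [_ * wedge_sign S T]mulrC wedge_sign_cocycle; ring.
under [RHS]eq_bigr => W _.
  under eq_bigr => V _.
    rewrite pext_mulE0 mulr_suml mulr_sumr.
    under eq_bigr do rewrite mulr_suml mulr_sumr.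
    over.
  over.
apply/esym.
under eq_bigr => W _ do rewrite exchange_big /=.
rewrite exchange_big /=; apply: eq_bigr => S _.
under eq_bigr => W _ do rewrite exchange_big /=.
rewrite (exchange_big_dep predT) //=; apply: eq_bigr => T _.
rewrite (big_pred1 (S :|: T)); last by move=> W; rewrite eq_sym.
by apply: eq_bigr => V _; ring.
Qed.

Lemma pext_mul1l : left_id pext_one (@pext_mul n).
Proof.
move=> p; apply/ffunP => U; rewrite pext_mulE0 (bigD1 set0) //= [X in _ + X]big1 => [|S nz].
  rewrite addr0 (big_pred1 U) => [|T]; last by rewrite set0U.
  by rewrite wedge_sign0l ffunE eqxx !mul1r.
by rewrite big1 // => T _; rewrite ffunE (negPf nz) mul0r mulr0.
Qed.

Lemma pext_mul1r : right_id pext_one (@pext_mul n).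
Proof.
move=> p; apply/ffunP => U; rewrite pext_mulE0 (exchange_big_dep predT) //=.
rewrite (bigD1 set0) //= [X in _ + X]big1 => [|S nz].
  rewrite addr0 (big_pred1 U) => [|T]; last by rewrite setU0.
  by rewrite wedge_sign0r ffunE eqxx mulr1 mul1r.
by rewrite big1 // => T _; rewrite ffunE (negPf nz) !mulr0.
Qed.

Lemma pext_mulDl : left_distributive (@pext_mul n) +%R.
Proof.
move=> p q r; apply/ffunP => U; rewrite [RHS]pext_addE !pext_mulE0 -big_split /=.
apply: eq_bigr => S _; rewrite -big_split /=; apply: eq_bigr => T _.
by rewrite pext_addE; ring.
Qed.

Lemma pext_mulDr : right_distributive (@pext_mul n) +%R.
Proof.
move=> p q r; apply/ffunP => U; rewrite [RHS]pext_addE !pext_mulE0 -big_split /=.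
apply: eq_bigr => S _; rewrite -big_split /=; apply: eq_bigr => T _.
by rewrite pext_addE; ring.
Qed.

Lemma pext_one_neq0 : pext_one != 0.
Proof.
by apply/eqP => /ffunP /(_ set0) /eqP; rewrite !ffunE eqxx oner_eq0.
Qed.

HB.instance Definition _ := GRing.Zmodule_isNzRing.Build (Pext n)
  pext_mulA pext_mul1l pext_mul1r pext_mulDl pext_mulDr pext_one_neq0.

Lemma pext_scaleE (c : rat) p S : (c *: p) S = c *: p S.
Proof. by rewrite ffunE. Qed.

Lemma pext_mulE p q U :
  (p * q) U = \sum_S \sum_(T | S :|: T == U) wedge_sign S T * (p S * q T).
Proof. exact: pext_mulE0. Qed.

Lemma pext_scaleAl (c : rat) p q : c *: (p * q) = (c *: p) * q.
Proof.
apply/ffunP => U; rewrite pext_scaleE !pext_mulE scaler_sumr.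
apply: eq_bigr => S _; rewrite scaler_sumr; apply: eq_bigr => T _.
by rewrite pext_scaleE -!scalerAl -scalerAr.
Qed.

HB.instance Definition _ :=
  GRing.Lmodule_isLalgebra.Build rat (Pext n) pext_scaleAl.

Lemma pext_scaleAr (c : rat) p q : c *: (p * q) = p * (c *: q).
Proof.
apply/ffunP => U; rewrite pext_scaleE !pext_mulE scaler_sumr.
apply: eq_bigr => S _; rewrite scaler_sumr; apply: eq_bigr => T _.
by rewrite pext_scaleE -!scalerAr.
Qed.

HB.instance Definition _ :=
  GRing.Lalgebra_isAlgebra.Build rat (Pext n) pext_scaleAr.

End PextRing.

HB.lock Definition polyP n (a : {mpoly rat[n]}) : Pext n :=
  [ffun S => if S == set0 then a else 0].

HB.lock Definition omegaS n (S : {set 'I_n}) : Pext n :=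
  [ffun T => (T == S)%:R].

Lemma polyPE n (a : {mpoly rat[n]}) S : polyP a S = if S == set0 then a else 0.
Proof. by rewrite [polyP]unlock ffunE. Qed.

Lemma omegaSE n (S T : {set 'I_n}) : omegaS S T = (T == S)%:R.
Proof. by rewrite [omegaS]unlock ffunE. Qed.

Definition omega n (i : 'I_n) : Pext n := omegaS [set i].

(* Substitution x_j |-> xs j, omega_j |-> ws j; enum S is increasing. *)
Definition pext_subst n (xs : 'I_n -> {mpoly rat[n]}) (ws : 'I_n -> Pext n)
    (p : Pext n) : Pext n :=
  \sum_S polyP (p S \mPo [tuple xs j | j < n]) * \prod_(j <- enum S) ws j.

Definition weyl_x n (i j : 'I_n) : {mpoly rat[n]} :=
  if (i.+1 < n)%N then 'X_(tperm i (ordS i) j)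
  else if j == i then - 'X_j else 'X_j.

Definition weyl_omega n (i j : 'I_n) : Pext n :=
  if (i.+1 < n)%N && (j == i)
  then omega j + polyP ('X_i ^+ 2 - 'X_(ordS i) ^+ 2) * omega (ordS i)
  else omega j.

(* The algebra automorphism s_i; see weyl_X, weyl_omegaE and
   weyl_is_monoid_morphism. When i.+1 < n, ordS i is i+1 (no wrap-around). *)
Definition weyl n (i : 'I_n) : Pext n -> Pext n :=
  pext_subst (weyl_x i) (weyl_omega i).


Lemma pext_1E n (S : {set 'I_n}) : (1 : Pext n) S = (S == set0)%:R.
Proof. exact: ffunE. Qed.

Lemma pext_0E n (S : {set 'I_n}) : (0 : Pext n) S = 0.
Proof. exact: ffunE. Qed.

Definition pextE := (polyPE, omegaSE, pext_1E, pext_0E).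

Section PextTheory.
Variable n : nat.
Implicit Types (S T U V : {set 'I_n}) (p q r : Pext n) (a b : {mpoly rat[n]}).
Implicit Types i j k : 'I_n.

Lemma polyP_mulE a p S : (polyP a * p) S = a * p S.
Proof.
rewrite pext_mulE (bigD1 set0) //= [X in _ + X]big1 => [|T nz].
  rewrite addr0 (big_pred1 S) => [|T]; last by rewrite set0U.
  by rewrite wedge_sign0l pextE eqxx mul1r.
by rewrite big1 // => V _; rewrite pextE (negPf nz) mul0r mulr0.
Qed.

Lemma mul_polyPE a p S : (p * polyP a) S = a * p S.
Proof.
rewrite pext_mulE (exchange_big_dep predT) //=.
rewrite (bigD1 set0) //= [X in _ + X]big1 => [|T nz].
  rewrite addr0 (big_pred1 S) => [|T]; last by rewrite setU0.
  by rewrite wedge_sign0r pextE eqxx mul1r mulrC.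
by rewrite big1 // => V _; rewrite pextE (negPf nz) !mulr0.
Qed.

Lemma polyP_central a p : polyP a * p = p * polyP a.
Proof. by apply/ffunP => S; rewrite polyP_mulE mul_polyPE. Qed.

Lemma polyP_is_linear : linear (@polyP n).
Proof.
move=> c a b; apply/ffunP => S; rewrite pext_addE pext_scaleE !pextE.
by case: eqP => // _; rewrite scaler0 addr0.
Qed.
HB.instance Definition _ :=
  GRing.isLinear.Build rat {mpoly rat[n]} (Pext n) _ (@polyP n) polyP_is_linear.

Lemma polyP_is_monoid_morphism : monoid_morphism (@polyP n).
Proof.
split=> [|a b]; apply/ffunP => S.
  by rewrite !pextE; case: eqP.
by rewrite polyP_mulE !pextE; case: eqP => // _; rewrite mulr0.
Qed.
HB.instance Definition _ := GRing.isMonoidMorphism.Build {mpoly rat[n]} (Pext n)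
  (@polyP n) polyP_is_monoid_morphism.

Lemma pext_sumE I (r : seq I) (P : pred I) (F : I -> Pext n) S :
  (\sum_(i <- r | P i) F i) S = \sum_(i <- r | P i) F i S.
Proof. exact: (big_morph (fun p : Pext n => p S) (fun p q => pext_addE p q S) (ffunE _ _)). Qed.

Lemma pext_decomp p : p = \sum_S polyP (p S) * omegaS S.
Proof.
apply/ffunP => T; rewrite pext_sumE (bigD1 T) //= big1 => [|S nST].
  by rewrite addr0 polyP_mulE pextE eqxx mulr1.
by rewrite polyP_mulE pextE eq_sym (negPf nST) mulr0.
Qed.

Lemma omegaSM S T : omegaS S * omegaS T = polyP (wedge_sign S T) * omegaS (S :|: T).
Proof.
apply/ffunP => U; rewrite polyP_mulE pext_mulE.
rewrite (bigD1 S) //= [X in _ + X]big1 => [|W nW]; last first.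
  by rewrite big1 // => V _; rewrite pextE (negPf nW) mul0r mulr0.
rewrite big_mkcond (bigD1 T) //= [X in _ + X + _]big1 => [|W nW]; last first.
  by rewrite !pextE (negPf nW) !mulr0 if_same.
by rewrite !pextE !eqxx eq_sym !addr0 !mulr1; case: eqP; rewrite ?mulr1 ?mulr0.
Qed.

Lemma wedge_sign11 (i j : 'I_n) :
  wedge_sign [set i] [set j] = if i == j then 0 else (-1) ^+ (j < i)%N.
Proof.
rewrite /wedge_sign -setI_eq0 /inversions !big_set1.
case: (eqVneq i j) => [->|nij]; first by rewrite setIid -cards_eq0 cards1.
case: eqP => // /eqP; rewrite setI_eq0 disjoints_subset sub1set !inE.
by rewrite nij.
Qed.

Lemma omega_sqr i : omega i * omega i = 0 :> Pext n.
Proof. by rewrite /omega omegaSM wedge_sign11 eqxx raddf0 mul0r. Qed.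

Lemma omega_anticomm i j : omega i * omega j = - (omega j * omega i) :> Pext n.
Proof.
rewrite /omega !omegaSM !wedge_sign11 eq_sym; case: eqVneq => [_|nij].
  by rewrite raddf0 !mul0r oppr0.
rewrite setUC !rmorph_sign.
by case: ltngtP nij => //= [_ _|_ _|/val_inj ->];
  rewrite ?eqxx // expr0 expr1 mulN1r mul1r ?opprK.
Qed.

Section Wedge.
Variable ws : 'I_n -> Pext n.
Hypothesis ws_sqr : forall i, ws i * ws i = 0.
Hypothesis ws_anti : forall i j, ws i * ws j = - (ws j * ws i).

Local Notation F S := (\prod_(j <- enum S) ws j).

Lemma prod_min (m : 'I_n) S : (forall j, j \in S -> (m < j)%N) -> F (m |: S) = ws m * F S.
Proof.
move=> mS; rewrite (_ : enum (m |: S) = m :: enum S) ?big_cons //.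
have enum_sorted (A : {set 'I_n}) : sorted (fun i j : 'I_n => i < j)%N (enum A).
  rewrite /enum_mem -enumT sorted_filter //.
    by move=> ? ? ?; apply: ltn_trans.
  rewrite -(sorted_map (f := val) (e' := ltn)) val_enum_ord.
  exact: iota_ltn_sorted.
apply: (@irr_sorted_eq _ (fun i j : 'I_n => i < j)%N) => //.
- by move=> ? ? ?; apply: ltn_trans.
- by move=> ?; rewrite /= ltnn.
- rewrite /= path_min_sorted //.
  by apply/allP => j; rewrite mem_enum => /mS.
- by move=> j; rewrite !inE !mem_enum !inE.
Qed.

Lemma prod0 : F set0 = 1.
Proof. by rewrite enum_set0 big_nil. Qed.

(* induction on finite sets, peeling off the least element *)
Lemma set_min_ind (P : {set 'I_n} -> Prop) :
  P set0 ->
  (forall (m : 'I_n) S, (forall j, j \in S -> (m < j)%N) -> P S -> P (m |: S)) ->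
  forall S, P S.
Proof.
move=> P0 Pm S; have [k] := ubnP #|S|; elim: k S => // k IH S.
rewrite ltnS => leSk; have [->//|/set0Pn[x xS]] := eqVneq S set0.
have [m mS' mmin] := arg_minnP (fun j : 'I_n => j : nat) xS.
have mS : m \in S := mS'.
rewrite -(setD1K mS); apply: Pm.
  move=> j; rewrite !inE => /andP[njm /mmin]; rewrite leq_eqVlt.
  by case/orP => // /eqP/val_inj ejm; rewrite ejm eqxx in njm.
by apply: IH; rewrite (cardsD1 m S) mS in leSk.
Qed.

Lemma wedge_sign_min (m : 'I_n) S :
  (forall j, j \in S -> (m < j)%N) -> wedge_sign [set m] S = 1.
Proof.
move=> mS; rewrite /wedge_sign disjoints_subset sub1set !inE.
case: (boolP (m \in S)) => [/mS|_]; first by rewrite ltnn.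
rewrite /inversions big_set1 big1 ?expr0 // => t /mS.
by rewrite ltnNge => /negPf; rewrite leq_eqVlt => /norP[_ /negPf->].
Qed.

Lemma prod_gen (i : 'I_n) S :
  ws i * F S = polyP (wedge_sign [set i] S) * F (i |: S).
Proof.
elim/set_min_ind: S i => [|m S mS IH] i.
  by rewrite wedge_sign0r rmorph1 mul1r prod_min ?prod0 // => j; rewrite inE.
rewrite (prod_min mS) mulrA.
have [im|mi|/val_inj->] := ltngtP i m.
- have iS j : j \in m |: S -> (i < j)%N.
    by rewrite !inE => /orP[/eqP->//|/mS]; apply: ltn_trans.
  by rewrite wedge_sign_min // rmorph1 mul1r (prod_min iS) (prod_min mS) mulrA.
- rewrite ws_anti mulNr -mulrA IH mulrA -polyP_central -mulrA -prod_min; last first.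
    by move=> j; rewrite !inE => /orP[/eqP->//|/mS].
  rewrite -mulNr -rmorphN setUCA; congr (_ * _); congr (polyP _).
  rewrite /wedge_sign !disjoints_subset !sub1set !inE -val_eqE gtn_eqF //=.
  case: ifP => _; last by rewrite oppr0.
  rewrite inversionsUr ?disjoints_subset ?sub1set ?inE.
    by rewrite {2}/inversions !big_set1 mi exprS mulN1r.
  by apply/negP => /mS; rewrite ltnn.
- rewrite ws_sqr mul0r (_ : wedge_sign _ _ = 0) ?raddf0 ?mul0r //.
  by rewrite /wedge_sign disjoints_subset sub1set !inE eqxx.
Qed.

Lemma prod_mul S T : F S * F T = polyP (wedge_sign S T) * F (S :|: T).
Proof.
elim/set_min_ind: S T => [|m S mS IH] T.
  by rewrite prod0 mul1r set0U wedge_sign0l rmorph1 mul1r.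
rewrite (prod_min mS) -mulrA IH mulrA -polyP_central -mulrA prod_gen mulrA -rmorphM setUA.
by rewrite -wedge_sign_cocycle (wedge_sign_min mS) mul1r.
Qed.

End Wedge.

Lemma omegaS_prod S : omegaS S = \prod_(j <- enum S) omega j.
Proof.
elim/set_min_ind: S => [|m S mS IH].
  by rewrite enum_set0 big_nil; apply/ffunP => S; rewrite !pextE.
rewrite prod_min // -IH omegaSM (wedge_sign_min mS).
by rewrite rmorph1 mul1r.
Qed.

Section Subst.
Variables (xs : 'I_n -> {mpoly rat[n]}) (ws : 'I_n -> Pext n).

Local Notation subst := (pext_subst xs ws).

Lemma pext_subst_is_linear : linear subst.
Proof.
move=> c p q; rewrite /pext_subst scaler_sumr -big_split /=.
apply: eq_bigr => S _; rewrite pext_addE pext_scaleE.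
by rewrite linearP /= linearP /= mulrDl scalerAl.
Qed.

HB.instance Definition _ :=
  GRing.isLinear.Build rat (Pext n) (Pext n) _ subst pext_subst_is_linear.

Lemma pext_subst_polyP a : subst (polyP a) = polyP (a \mPo [tuple xs j | j < n]).
Proof.
rewrite /pext_subst (bigD1 set0) //= [X in _ + X]big1 => [|S nS].
  by rewrite enum_set0 big_nil mulr1 addr0 pextE eqxx.
by rewrite pextE (negPf nS) !raddf0 mul0r.
Qed.

Lemma pext_subst_omega i : subst (omega i) = ws i.
Proof.
rewrite /pext_subst (bigD1 [set i]) //= [X in _ + X]big1 => [|S nS].
  by rewrite enum_set1 big_seq1 addr0 pextE eqxx !rmorph1 mul1r.
by rewrite pextE (negPf nS) !raddf0 mul0r.
Qed.

Hypothesis ws_sqr : forall i, ws i * ws i = 0.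
Hypothesis ws_anti : forall i j, ws i * ws j = - (ws j * ws i).

Lemma comp_wedge_sign S T (lq : n.-tuple {mpoly rat[n]}) :
  wedge_sign S T \mPo lq = wedge_sign S T.
Proof.
by rewrite /wedge_sign; case: ifP => _; rewrite ?rmorph_sign ?raddf0.
Qed.

Lemma pext_substM p q : subst (p * q) = subst p * subst q.
Proof.
rewrite {2 3}/pext_subst mulr_suml.
under [RHS]eq_bigr do rewrite mulr_sumr.
rewrite /pext_subst.
transitivity (\sum_U \sum_S \sum_(T | S :|: T == U)
    polyP ((wedge_sign S T * (p S * q T)) \mPo [tuple xs j | j < n]) *
    \prod_(j <- enum U) ws j).
  apply: eq_bigr => U _.
  rewrite pext_mulE (raddf_sum (comp_mpoly _)) (raddf_sum (@polyP n)) mulr_suml.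
  apply: eq_bigr => S _.
  by rewrite (raddf_sum (comp_mpoly _)) (raddf_sum (@polyP n)) mulr_suml.
rewrite exchange_big /=; apply: eq_bigr => S _.
rewrite (exchange_big_dep predT) //=; apply: eq_bigr => T _.
rewrite (big_pred1 (S :|: T)) => [|U]; last by rewrite eq_sym.
have compM a b (lq : n.-tuple {mpoly rat[n]}) :
    (a * b) \mPo lq = (a \mPo lq) * (b \mPo lq) by exact: rmorphM.
have PM a b : polyP (a * b) = polyP a * polyP b by exact: rmorphM.
rewrite !compM comp_wedge_sign !PM.
move: (p S \mPo _) (q T \mPo _) => a b.
transitivity (polyP a * polyP b *
  (\prod_(j <- enum S) ws j * \prod_(j <- enum T) ws j)).
  rewrite prod_mul // [RHS]mulrA; congr (_ * _).
  by rewrite -!PM; congr polyP; ring.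
by rewrite -!mulrA; congr (_ * _); rewrite !mulrA polyP_central.
Qed.


End Subst.

Lemma polyPB a b : polyP (a - b) = polyP a - polyP b.
Proof. exact: raddfB. Qed.

Lemma polyPM a b : polyP (a * b) = polyP a * polyP b.
Proof. exact: rmorphM. Qed.

Lemma polyPZ (c : rat) a : polyP (c *: a) = c *: polyP a.
Proof. exact: linearZ. Qed.

Definition weyl_coef (i j : 'I_n) : {mpoly rat[n]} :=
  if (i.+1 < n)%N && (j == i) then 'X_i ^+ 2 - 'X_(ordS i) ^+ 2 else 0.

Lemma weyl_omegaD i j :
  weyl_omega i j = omega j + polyP (weyl_coef i j) * omega (ordS i).
Proof.
rewrite /weyl_omega /weyl_coef; case: ifP => // _.
by rewrite raddf0 mul0r addr0.
Qed.

Lemma mul_omega_shift a b (j k l : 'I_n) :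
  (omega j + polyP a * omega k) * (omega l + polyP b * omega k) =
  omega j * omega l + polyP b * (omega j * omega k) + polyP a * (omega k * omega l).
Proof.
rewrite mulrDl !mulrDr -!mulrA (mulrA (omega k)) -(polyP_central b (omega k)).
by rewrite -mulrA omega_sqr !mulr0 addr0 !mulrA -(polyP_central b (omega j)).
Qed.

Lemma weyl_omega_sqr i j : weyl_omega i j * weyl_omega i j = 0.
Proof.
rewrite weyl_omegaD mul_omega_shift omega_sqr add0r (omega_anticomm j).
by rewrite mulrN addNr.
Qed.

Lemma weyl_omega_anti i j k :
  weyl_omega i j * weyl_omega i k = - (weyl_omega i k * weyl_omega i j).
Proof.
rewrite !weyl_omegaD !mul_omega_shift (omega_anticomm k j).
rewrite (omega_anticomm k (ordS i)) (omega_anticomm (ordS i) j).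
by rewrite !mulrN !opprD !opprK addrAC.
Qed.

HB.instance Definition _ (i : 'I_n) := GRing.Linear.copy (weyl i)
  (pext_subst (weyl_x i) (weyl_omega i)).

Lemma weyl_is_monoid_morphism (i : 'I_n) : monoid_morphism (weyl i).
Proof.
split=> [|p q]; last first.
  by apply: pext_substM; [apply: weyl_omega_sqr | apply: weyl_omega_anti].
by rewrite -(rmorph1 (@polyP n)) /weyl pext_subst_polyP comp_mpoly1.
Qed.

HB.instance Definition _ (i : 'I_n) :=
  GRing.isMonoidMorphism.Build (Pext n) (Pext n)
    (weyl i) (weyl_is_monoid_morphism i).

Lemma weyl_X i j : weyl i (polyP 'X_j) = polyP (weyl_x i j).
Proof. by rewrite /weyl pext_subst_polyP comp_mpolyXU -tnth_nth tnth_mktuple. Qed.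

Lemma weyl_omegaE i j : weyl i (omega j) = weyl_omega i j.
Proof. exact: pext_subst_omega. Qed.

Lemma pext_ind (P : Pext n -> Prop) :
  (forall c p q, P p -> P q -> P (c *: p + q)) ->
  (forall p q, P p -> P q -> P (p * q)) ->
  P 1 -> (forall i, P (polyP 'X_i)) -> (forall i, P (omega i)) ->
  forall p, P p.
Proof.
move=> PD PM P1 PX Pw p.
have P0 : P 0 by rewrite -(subrr 1) addrC -scaleN1r; apply: PD.
have Psum I (r : seq I) Q (F : I -> Pext n) :
    (forall x, P (F x)) -> P (\sum_(x <- r | Q x) F x).
  move=> PF; elim/big_ind: _ => // u v Pu Pv.
  by rewrite -(scale1r u); apply: PD.
have Pprod I (r : seq I) Q (F : I -> Pext n) :
    (forall x, P (F x)) -> P (\prod_(x <- r | Q x) F x).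
  by move=> PF; elim/big_ind: _.
rewrite (pext_decomp p); apply: (Psum) => S; apply: (PM); last first.
  by rewrite omegaS_prod; apply: (Pprod).
rewrite (mpolyE (p S)) (raddf_sum (@polyP n)); apply: (Psum) => m.
rewrite /= polyPZ -[_ *: _]addr0; apply: PD => //.
rewrite mpolyXE_id (rmorph_prod (@polyP n)); apply: (Pprod) => i.
rewrite /= (rmorphXn (@polyP n)) /=; elim: (m i) => [|e IH]; first by rewrite expr0.
by rewrite exprS; apply: (PM).
Qed.

Lemma demazure_exists i p :
  exists q, (polyP 'X_i - weyl i (polyP 'X_i)) * q == p - weyl i p.
Proof.
set d := polyP 'X_i - _.
have dC q : d * q = q * d by rewrite /d weyl_X -polyPB polyP_central.
elim/pext_ind: p => [c p q [u /eqP pu] [v /eqP qv]|p q [u /eqP pu] [v /eqP qv]|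
    |j|j].
- exists (c *: u + v); apply/eqP.
  by rewrite mulrDr -scalerAr pu qv linearP /= scalerBr opprD addrACA.
- exists (u * q + weyl i p * v); apply/eqP.
  rewrite mulrDr mulrA pu mulrA dC -mulrA qv rmorphM /= mulrBl mulrBr.
  by rewrite addrA subrK.
- by exists 0; rewrite mulr0 rmorph1 subrr.
- rewrite /d !weyl_X /weyl_x; case: ifP => _; last first.
    by case: (eqVneq j i) => [->|nij]; [exists 1; rewrite eqxx mulr1
      | exists 0; rewrite mulr0 subrr].
  case: (tpermP i (ordS i) j) => [->|->|_ _].
  + by exists 1; rewrite tpermL mulr1.
  + by exists (- 1); rewrite tpermL mulrN1 opprB.
  + by exists 0; rewrite mulr0 subrr.
- rewrite /d weyl_X weyl_omegaE weyl_omegaD opprD addrA subrr add0r.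
  rewrite /weyl_coef; case: ifP => [/andP[lt_in _]|_]; last first.
    by exists 0; rewrite raddf0 mul0r oppr0 mulr0.
  exists (- (polyP ('X_i + 'X_(ordS i)) * omega (ordS i))).
  rewrite /weyl_x lt_in tpermL mulrN mulrA -polyPB -polyPM; apply/eqP.
  by congr (- (_ * _)); congr polyP; ring.
Qed.

End PextTheory.

(* The exact quotient of p - s_i p by x_i - s_i x_i: it exists by
   demazure_exists and is unique by demazure_den_reg. *)
HB.lock Definition demazure n (i : 'I_n) (p : Pext n) : Pext n :=
  xchoose (demazure_exists i p).

Lemma demazureP n (i : 'I_n) (p : Pext n) :
  (polyP 'X_i - weyl i (polyP 'X_i)) * demazure i p = p - weyl i p.
Proof. by rewrite [demazure]unlock; apply: eqP (xchooseP (demazure_exists i p)). Qed.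

Lemma demazure_den_neq0 n (i : 'I_n) : 'X_i - weyl_x i i != 0.
Proof.
rewrite /weyl_x eqxx; case: ifP => [lt_in|_].
  rewrite tpermL; apply/eqP => /(congr1 (mcoeff U_(i))).
  rewrite mcoeffB !mcoeffX mcoeff0 eqxx; case: eqP => [|_ /eqP].
    move=> /mnmP /(_ i); rewrite !mnm1E eqxx; case: eqP => // e _.
    by have := congr1 val e; rewrite /= modn_small // => /eqP; rewrite eqn_leq ltnn.
  by rewrite subr0 oner_eq0.
rewrite opprK -mulr2n; apply/eqP => /(congr1 (mcoeff U_(i))).
by rewrite mcoeffMn mcoeffX mcoeff0 eqxx => /eqP.
Qed.

Lemma demazure_den_reg n (i : 'I_n) :
  GRing.lreg (polyP 'X_i - weyl i (polyP 'X_i)).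
Proof.
move=> p q /ffunP epq; apply/ffunP => S; have := epq S.
by rewrite weyl_X -polyPB !polyP_mulE; apply: mulfI; apply: demazure_den_neq0.
Qed.

Lemma demazure_is_linear n (i : 'I_n) : linear (@demazure n i).
Proof.
move=> c p q; apply: (@demazure_den_reg _ i).
rewrite mulrDr -scalerAr !demazureP linearP /= scalerBr opprD.
by rewrite addrACA.
Qed.

Lemma demazure_eq0 n (i : 'I_n) (p : Pext n) :
  (demazure i p == 0) = (weyl i p == p).
Proof.
rewrite -(inj_eq (@demazure_den_reg _ i)) demazureP mulr0 subr_eq0.
by rewrite eq_sym.
Qed.

HB.instance Definition _ n (i : 'I_n) :=
  GRing.isLinear.Build rat (Pext n) (Pext n) _ (@demazure n i)
    (@demazure_is_linear n i).

Definition Lam_pred n : {pred Pext n} :=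
  [pred p | [forall i, demazure i p == 0]].
Arguments Lam_pred n : clear implicits.

Lemma Lam_predP n (p : Pext n) :
  reflect (forall i, weyl i p = p) (p \in Lam_pred n).
Proof.
apply: (iffP forallP) => h i; last by rewrite demazure_eq0; apply/eqP.
by apply/eqP; rewrite -demazure_eq0.
Qed.

Lemma Lam_pred_subalg n : GRing.subalg_closed (Lam_pred n).
Proof.
split=> [|c p q|p q].
- by apply/Lam_predP => i; rewrite rmorph1.
- move=> /Lam_predP hp /Lam_predP hq; apply/Lam_predP => i.
  by rewrite linearP /= hp hq.
- move=> /Lam_predP hp /Lam_predP hq; apply/Lam_predP => i.
  by rewrite rmorphM /= hp hq.
Qed.

HB.instance Definition _ n := GRing.isSubalgClosed.Build rat (Pext n)
  (Lam_pred n) (GRing.subalg_closed_semi (@Lam_pred_subalg n)).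

Record Lam n := MkLam { Lam_val :> Pext n; _ : Lam_val \in Lam_pred n }.

HB.instance Definition _ n := [isSub for @Lam_val n].
HB.instance Definition _ n := [Choice of Lam n by <:].
HB.instance Definition _ n := [SubChoice_isSubLalgebra of Lam n by <:].

(* The Q-algebra of all Q-linear operators on Pext n, under composition. *)
Record linop n := Linop {
  linop_fun :> Pext n -> Pext n;
  _ : `[< linear linop_fun >] }.

HB.instance Definition _ n := [isSub for @linop_fun n].
HB.instance Definition _ n := [Choice of linop n by <:].

Definition mk_linop n (f : Pext n -> Pext n) (lf : linear f) : linop n :=
  Linop (asboolT lf).

Section LinopAlgebra.
Variable n : nat.
Implicit Types (f g h : linop n) (p q : Pext n) (c : rat).

Lemma linopP f g : f =1 g -> f = g.
Proof. by move=> fg; apply: val_inj; apply: funext. Qed.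

Lemma linop_linear f : linear f.
Proof. by case: f => f lf; apply: asboolW lf. Qed.

HB.instance Definition _ f :=
  GRing.isLinear.Build rat (Pext n) (Pext n) _ f (linop_linear f).

Lemma linop0_subproof : linear (fun _ : Pext n => 0 : Pext n).
Proof. by move=> c p q; rewrite scaler0 addr0. Qed.

Lemma linop1_subproof : linear (fun p : Pext n => p).
Proof. by []. Qed.

Lemma linopN_subproof f : linear (fun p => - f p).
Proof. by move=> c p q; rewrite linearP /= opprD scalerN. Qed.

Lemma linopD_subproof f g : linear (fun p => f p + g p).
Proof. by move=> c p q; rewrite !linearP /= scalerDr addrACA. Qed.

Lemma linopM_subproof f g : linear (fun p => f (g p)).
Proof. by move=> c p q; rewrite !linearP. Qed.

Lemma linopZ_subproof c f : linear (fun p => c *: f p).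
Proof.
by move=> d p q; rewrite linearP /= scalerDr !scalerA (mulrC c).
Qed.

Let zero := mk_linop linop0_subproof.
Let one := mk_linop linop1_subproof.
Let opp f := mk_linop (linopN_subproof f).
Let add f g := mk_linop (linopD_subproof f g).
Let mul f g := mk_linop (linopM_subproof f g).
Let scale c f := mk_linop (linopZ_subproof c f).

Let addA : associative add.
Proof. by move=> f g h; apply: linopP => p; apply: addrA. Qed.
Let addC : commutative add.
Proof. by move=> f g; apply: linopP => p; apply: addrC. Qed.
Let add0 : left_id zero add.
Proof. by move=> f; apply: linopP => p; apply: add0r. Qed.
Let addN : left_inverse zero opp add.
Proof. by move=> f; apply: linopP => p; apply: addNr. Qed.

HB.instance Definition _ := GRing.isZmodule.Build (linop n) addA addC add0 addN.

Let mulA : associative mul.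
Proof. by move=> f g h; apply: linopP. Qed.
Let mul1l : left_id one mul.
Proof. by move=> f; apply: linopP. Qed.
Let mul1r : right_id one mul.
Proof. by move=> f; apply: linopP. Qed.
Let mulDl : left_distributive mul +%R.
Proof. by move=> f g h; apply: linopP. Qed.
Let mulDr : right_distributive mul +%R.
Proof. by move=> f g h; apply: linopP => p; apply: linearD. Qed.
Let one_neq0 : one != 0.
Proof.
apply/eqP => /(congr1 (fun f : linop n => f 1)) /eqP.
by rewrite [_ == _](oner_eq0 (Pext n)).
Qed.

HB.instance Definition _ := GRing.Zmodule_isNzRing.Build (linop n)
  mulA mul1l mul1r mulDl mulDr one_neq0.

Let scaleA c d f : scale c (scale d f) = scale (c * d) f.
Proof. by apply: linopP => p; apply: scalerA. Qed.
Let scale1 : left_id 1 scale.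
Proof. by move=> f; apply: linopP => p; apply: scale1r. Qed.
Let scaleDr : right_distributive scale +%R.
Proof. by move=> c f g; apply: linopP => p; apply: scalerDr. Qed.
Let scaleDl f : {morph scale^~ f : c d / c + d}.
Proof. by move=> c d; apply: linopP => p; apply: scalerDl. Qed.

HB.instance Definition _ := GRing.Zmodule_isLmodule.Build rat (linop n)
  scaleA scale1 scaleDr scaleDl.

Let scaleAl c f g : c *: (f * g) = (c *: f) * g.
Proof. by apply: linopP. Qed.

HB.instance Definition _ :=
  GRing.Lmodule_isLalgebra.Build rat (linop n) scaleAl.

Lemma linop_addE f g p : (f + g) p = f p + g p. Proof. by []. Qed.
Lemma linop_scaleE c f p : (c *: f) p = c *: f p. Proof. by []. Qed.
Lemma linop_mulE f g p : (f * g) p = f (g p). Proof. by []. Qed.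
Lemma linop_oneE p : (1 : linop n) p = p. Proof. by []. Qed.

End LinopAlgebra.

Lemma pext_lmul_linear n (p : Pext n) : linear (fun q : Pext n => p * q).
Proof. by move=> c q r; rewrite mulrDr scalerAr. Qed.

Definition lmul_op n (p : Pext n) : linop n := mk_linop (pext_lmul_linear p).

Definition demazure_op n (i : 'I_n) : linop n :=
  mk_linop (demazure_is_linear i).

Inductive in_NH n : linop n -> Prop :=
| in_NH_mul p : in_NH (lmul_op p)
| in_NH_demazure i : in_NH (demazure_op i)
| in_NH_linear c f g : in_NH f -> in_NH g -> in_NH (c *: f + g)
| in_NH_comp f g : in_NH f -> in_NH g -> in_NH (f * g).

Definition NH_pred n : {pred linop n} := fun f => `[< in_NH f >].
Arguments NH_pred n : clear implicits.

Lemma NH_pred_subalg n : GRing.subalg_closed (NH_pred n).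
Proof.
split=> [|c f g /asboolP hf /asboolP hg|f g /asboolP hf /asboolP hg].
- apply/asboolP; rewrite (_ : 1 = lmul_op 1); first exact: in_NH_mul.
  by apply: linopP => p; rewrite /= mul1r.
- by apply/asboolP; apply: in_NH_linear.
- by apply/asboolP; apply: in_NH_comp.
Qed.

HB.instance Definition _ n := GRing.isSubalgClosed.Build rat (linop n)
  (NH_pred n) (GRing.subalg_closed_semi (@NH_pred_subalg n)).

Record NH n := MkNH { NH_val :> linop n; _ : NH_val \in NH_pred n }.

HB.instance Definition _ n := [isSub for @NH_val n].
HB.instance Definition _ n := [Choice of NH n by <:].
HB.instance Definition _ n := [SubChoice_isSubLalgebra of NH n by <:].

(* Z-degree: deg x_i = 1 and deg omega_i = -2(i+1) for the 0-based i. *)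
Definition pext_homog n (d : int) (p : Pext n) : Prop :=
  forall S m, m \in msupp (p S) ->
    (mdeg m)%:Z - (\sum_(i in S) 2 * i.+1)%N%:Z = d.

Definition pext_parity n (e : bool) (p : Pext n) : Prop :=
  forall S, p S != 0 -> odd #|S| = e.

Definition op_homog n (d : int) (f : linop n) : Prop :=
  forall k p, pext_homog k p -> pext_homog (k + d) (f p).

Definition op_parity n (e : bool) (f : linop n) : Prop :=
  forall b p, pext_parity b p -> pext_parity (b (+) e) (f p).

(* f is homogeneous of parity e and f (l m) = (-1)^(|f||l|) l f(m). *)
Definition superlinear n (e : bool) (f : linop n) : Prop :=
  op_parity e f /\
  forall (b : bool) (l m : Pext n), l \in Lam_pred n -> pext_parity b l ->
    f (l * m) = (-1) ^+ (e && b) * (l * f m).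

(* Sums of (parity-)homogeneous superlinear maps. Requiring maps to be
   Q-linear is no restriction, as Q lies in the even part of Lam n. *)
Definition EndLam_pred n : {pred linop n} := fun f =>
  `[< exists f0 f1, [/\ superlinear false f0, superlinear true f1
                      & f = f0 + f1] >].
Arguments EndLam_pred n : clear implicits.

Lemma pext_parityD n b (c : rat) (p q : Pext n) :
  pext_parity b p -> pext_parity b q -> pext_parity b (c *: p + q).
Proof.
move=> hp hq S; rewrite pext_addE pext_scaleE.
have [->|/hp //] := eqVneq (p S) 0.
by rewrite scaler0 add0r => /hq.
Qed.

Lemma superlinearP n e c (f g : linop n) :
  superlinear e f -> superlinear e g -> superlinear e (c *: f + g).
Proof.
move=> [pf lf] [pg lg]; split=> [b p hp|b l m hl hb].
  by apply: pext_parityD; [apply: pf | apply: pg].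
rewrite !linop_addE !linop_scaleE (lf b) // (lg b) //.
by rewrite !mulrDr -!scalerAr.
Qed.

Lemma superlinearM n e e' (f g : linop n) :
  superlinear e f -> superlinear e' g -> superlinear (e (+) e') (f * g).
Proof.
move=> [pf lf] [pg lg]; split=> [b p hp|b l m hl hb].
  by rewrite [e (+) e']addbC addbA; apply: pf; apply: pg.
have f_sgn (c : bool) q : f ((-1) ^+ c * q) = (-1) ^+ c * f q.
  by case: c; rewrite ?mul1r // !mulN1r linearN.
rewrite !linop_mulE (lg b) // f_sgn (lf b) // mulrA -signr_addb.
by rewrite andb_addl addbC.
Qed.

Lemma EndLam_pred_subalg n : GRing.subalg_closed (EndLam_pred n).
Proof.
have s0 e : superlinear e (0 : linop n).
  split=> [b p _ S|b l m _ _]; first by rewrite [(0 : linop n) p]/= pext_0E eqxx.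
  by rewrite [(0 : linop n) _]/= !mulr0.
split=> [|c _ _ /asboolP[f0 [f1 [hf0 hf1 ->]]] /asboolP[g0 [g1 [hg0 hg1 ->]]]|
  _ _ /asboolP[f0 [f1 [hf0 hf1 ->]]] /asboolP[g0 [g1 [hg0 hg1 ->]]]];
  apply/asboolP.
- exists 1, 0; split; [|exact: s0|by rewrite addr0].
  by split=> [b p|b l m _ _]; rewrite ?addbF //= mul1r.
- exists (c *: f0 + g0), (c *: f1 + g1); split; try exact: superlinearP.
  by rewrite scalerDr addrACA.
- exists (1 *: (f0 * g0) + f1 * g1), (1 *: (f0 * g1) + f1 * g0); split.
  + by apply: superlinearP; [apply: (superlinearM hf0 hg0) |
      apply: (superlinearM hf1 hg1)].
  + by apply: superlinearP; [apply: (superlinearM hf0 hg1) |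
      apply: (superlinearM hf1 hg0)].
  + by rewrite !scale1r mulrDl !mulrDr [f1 * g0 + _]addrC addrACA.
Qed.

HB.instance Definition _ n := GRing.isSubalgClosed.Build rat (linop n)
  (EndLam_pred n) (GRing.subalg_closed_semi (@EndLam_pred_subalg n)).

Record EndLam n :=
  MkEndLam { EndLam_val :> linop n; _ : EndLam_val \in EndLam_pred n }.

HB.instance Definition _ n := [isSub for @EndLam_val n].
HB.instance Definition _ n := [Choice of EndLam n by <:].
HB.instance Definition _ n := [SubChoice_isSubLalgebra of EndLam n by <:].

Definition poincareB n : {poly nat} :=
  \prod_(i < n) \sum_(k < 2 * i.+1) 'X^k.

(* The a_k, with multiplicity, such that P(q) = sum_k q^(a_k). *)
Definition exponents (P : {poly nat}) : seq nat :=
  flatten [seq nseq (P`_k)%R k | k <- iota 0 (size P)].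

Lemma exponentsE (P : {poly nat}) : \sum_(k <- exponents P) 'X^k = P.
Proof.
rewrite big_flatten big_map -[RHS]coefK poly_def /=.
rewrite -[X in iota _ X]subn0 -/(index_iota 0 (size P)) big_mkord.
apply: eq_bigr => k _; rewrite big_nseq iter_addr_0.
by rewrite -scaler_nat natn.
Qed.

Lemma size_exponents (P : {poly nat}) : size (exponents P) = P.[1].
Proof.
rewrite -{2}(exponentsE P) horner_sum -sum1_size.
by apply: eq_bigr => k _; rewrite hornerXn expr1n.
Qed.

Definition Mat (P : {poly nat}) (R : Type) := 'M[R]_(P.[1]).

Definition basis_deg (P : {poly nat}) (i : 'I_(P.[1])) : nat :=
  nth 0%N (exponents P) i.

(* Matrices act on the free right Lam n-module with even basis elements e_i in
   degrees basis_deg i by e_j |-> sum_i e_i M_ij, so in degree d the entry M_ij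
   has degree d + deg e_j - deg e_i. *)
Definition mat_homog n (P : {poly nat}) (d : int) (M : Mat P (Lam n)) : Prop :=
  forall i j, pext_homog (d + (basis_deg j)%:Z - (basis_deg i)%:Z) (M i j : Lam n).

Definition mat_parity n (P : {poly nat}) (e : bool) (M : Mat P (Lam n)) : Prop :=
  forall i j, pext_parity e (M i j : Lam n).

(* Main.v *)
(* Staircase monomials x^J (the j-th variable, j = 0 .. n-1, to a power < 2(n-j)) form a
   basis of Pext over Lam, and NH contains the dual coordinate functions; hence NH is
   everything right Lam-linear, and coordinates identify End with matrices.

   Coordinates.  Let p be fixed by s_m, ..., s_(n-1) (indices from 0) and k = n - m.
   Along the palindromic word m, m+1, ..., n-1, ..., m+1, m of length 2k-1, the Demazure
   operators send x_m^a p to (t^a)[x_m, ..., x_(n-1), -x_(n-1), ..., -x_m] p, a divided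
   difference, which is 0 for a < 2k-1 and p for a = 2k-1.  Coefficients of a combination
   sum_(a < 2k) x_m^a p_a are thus read off inside NH, from the top down; iterating over m
   gives the coordinates.

   Spanning.  x_m^2 is a root of the monic polynomial prod_(j >= m) (t - x_j^2), whose
   coefficients lie in Lam[x_0, ..., x_(m-1)].  The omega_k are reached through the
   invariants sum_j e_(j-k)(x_0^2, ..., x_(j-1)^2) omega_j. *)
From HB Require Import structures.
From mathcomp Require Import all_boot all_order all_algebra.
From mathcomp Require Import perm boolp mpoly ring zify.
Require Import Defs.

Set Implicit Arguments.
Unset Strict Implicit.
Unset Printing Implicit Defensive.

Import GRing.Theory.
Local Open Scope ring_scope.

(** * Gradings *)

(** Here [u] is the weight of every variable x_i and [w i] that of omega_i; the condition gives all
    terms of s_i(omega_i) the same weight. Weights lie in an arbitrary group so that the integer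
    degree and the parity are treated at once. *)
Definition weyl_grading n (Z : zmodType) (u : Z) (w : 'I_n -> Z) :=
  forall i : 'I_n, (i.+1 < n)%N -> w i = u *+ 2 + w (ordS i).

Section Grading.
Variables (n : nat) (Z : zmodType) (u : Z) (w : 'I_n -> Z).
Hypothesis weyl_weight : weyl_grading u w.
Implicit Types (S T : {set 'I_n}) (z : Z) (a b : {mpoly rat[n]}) (p q : Pext n).

Definition mpoly_graded z a := forall m, m \in msupp a -> u *+ mdeg m = z.

Definition graded z p :=
  forall S m, m \in msupp (p S) -> u *+ mdeg m + \sum_(i in S) w i = z.

Lemma gradedP z p :
  graded z p <-> forall S, mpoly_graded (z - \sum_(i in S) w i) (p S).
Proof.
split=> gp S m; first by move=> /gp <-; rewrite addrK.
by move=> /gp ->; rewrite subrK.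
Qed.

Lemma mpoly_graded0 z : mpoly_graded z 0.
Proof. by move=> m; rewrite msupp0. Qed.

Lemma mpoly_gradedZ z (c : rat) a : mpoly_graded z a -> mpoly_graded z (c *: a).
Proof. by move=> ga m /msuppZ_le /ga. Qed.

Lemma mpoly_gradedD z a b :
  mpoly_graded z a -> mpoly_graded z b -> mpoly_graded z (a + b).
Proof. by move=> ga gb m /msuppD_le; rewrite mem_cat => /orP[/ga|/gb]. Qed.

Lemma mpoly_gradedN z a : mpoly_graded z a -> mpoly_graded z (- a).
Proof. by rewrite -scaleN1r; apply: mpoly_gradedZ. Qed.

Lemma mpoly_graded_sum I (r : seq I) (P : pred I) z F :
  (forall i, P i -> mpoly_graded z (F i)) ->
  mpoly_graded z (\sum_(i <- r | P i) F i).
Proof.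
move=> gF; elim/big_rec: _ => [|i a /gF gi ga]; first exact: mpoly_graded0.
exact: mpoly_gradedD.
Qed.

Lemma mpoly_graded1 : mpoly_graded 0 1.
Proof. by move=> m; rewrite msupp1 inE => /eqP->; rewrite mdeg0 mulr0n. Qed.

Lemma mpoly_gradedM y z a b :
  mpoly_graded y a -> mpoly_graded z b -> mpoly_graded (y + z) (a * b).
Proof.
move=> ga gb m /msuppM_le /allpairsP[[m1 m2] /= [/ga <- /gb <- ->]].
by rewrite mdegD mulrnDr.
Qed.

Lemma mpoly_gradedX i : mpoly_graded u 'X_i.
Proof. by move=> m; rewrite msuppX inE => /eqP->; rewrite mdeg1. Qed.

Lemma mpoly_gradedXn z k a : mpoly_graded z a -> mpoly_graded (z *+ k) (a ^+ k).
Proof.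
move=> ga; elim: k => [|k IH]; first exact: mpoly_graded1.
by rewrite exprS mulrS; apply: mpoly_gradedM.
Qed.

Lemma mpoly_graded_prod I (r : seq I) (k : I -> nat) F :
  (forall i, mpoly_graded (u *+ k i) (F i)) ->
  mpoly_graded (u *+ \sum_(i <- r) k i) (\prod_(i <- r) F i).
Proof.
move=> gF; elim: r => [|i r IH]; first by rewrite !big_nil; apply: mpoly_graded1.
by rewrite !big_cons mulrnDr; apply: mpoly_gradedM.
Qed.

Lemma mpoly_graded_comp z a (t : 'I_n -> {mpoly rat[n]}) :
  (forall i, mpoly_graded u (t i)) -> mpoly_graded z a ->
  mpoly_graded z (a \mPo [tuple t i | i < n]).
Proof.
move=> gt ga; rewrite comp_mpolyEX big_seq_cond; apply: mpoly_graded_sum => m.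
rewrite andbT => /ga <-; apply: mpoly_gradedZ; rewrite comp_mpolyX mdegE.
apply: mpoly_graded_prod => i; rewrite tnth_mktuple.
exact: mpoly_gradedXn.
Qed.

Lemma mpoly_graded_sign e : mpoly_graded 0 ((-1) ^+ e).
Proof.
by rewrite -[0](mul0rn Z e); apply/mpoly_gradedXn/mpoly_gradedN/mpoly_graded1.
Qed.

Lemma graded0 z : graded z 0.
Proof. by move=> S m; rewrite pext_0E msupp0. Qed.

Lemma gradedD z p q : graded z p -> graded z q -> graded z (p + q).
Proof.
move=> /gradedP gp /gradedP gq; apply/gradedP => S; rewrite pext_addE.
exact: mpoly_gradedD.
Qed.

Lemma gradedZ z (c : rat) p : graded z p -> graded z (c *: p).
Proof.
move=> /gradedP gp; apply/gradedP => S; rewrite pext_scaleE.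
exact: mpoly_gradedZ.
Qed.

Lemma gradedN z p : graded z p -> graded z (- p).
Proof. by rewrite -scaleN1r; apply: gradedZ. Qed.

Lemma graded_sum I (r : seq I) (P : pred I) z F :
  (forall i, P i -> graded z (F i)) -> graded z (\sum_(i <- r | P i) F i).
Proof.
move=> gF; elim/big_rec: _ => [|i a /gF gi ga]; first exact: graded0.
exact: gradedD.
Qed.

Lemma gradedM y z p q : graded y p -> graded z q -> graded (y + z) (p * q).
Proof.
move=> /gradedP gp /gradedP gq; apply/gradedP => U; rewrite pext_mulE.
apply: mpoly_graded_sum => S _; apply: mpoly_graded_sum => T /eqP <-.
rewrite /wedge_sign; case: ifP => [dST|_]; last first.
  by rewrite mul0r; apply: mpoly_graded0.
rewrite -[_ - _]add0r; apply: mpoly_gradedM; first exact: mpoly_graded_sign.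
rewrite (_ : \sum_(i in _) _ = \sum_(i in S) w i + \sum_(i in T) w i).
  by rewrite opprD addrACA; apply: mpoly_gradedM.
by rewrite -bigU //; apply: eq_bigl => i; rewrite !inE.
Qed.

Lemma graded_polyP z a : graded z (polyP a) <-> mpoly_graded z a.
Proof.
split=> [/gradedP/(_ set0)|ga].
  by rewrite big_set0 subr0 polyPE eqxx.
move=> S m; rewrite polyPE; case: eqP => [->|_]; last by rewrite msupp0.
by rewrite big_set0 addr0; apply: ga.
Qed.

Lemma graded1 : graded 0 1.
Proof. by rewrite -(rmorph1 (@polyP n)); apply/graded_polyP/mpoly_graded1. Qed.

Lemma graded_omega i : graded (w i) (omega i).
Proof.
move=> S m; rewrite omegaSE; case: eqP => [->|_]; last by rewrite msupp0.
by rewrite msupp1 inE big_set1 => /eqP->; rewrite mdeg0 mulr0n add0r.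
Qed.

Lemma graded_weyl_omega i j : graded (w j) (weyl_omega i j).
Proof.
rewrite /weyl_omega; case: ifP => [/andP[lt_in /eqP->]|_]; last exact: graded_omega.
apply: gradedD; first exact: graded_omega.
rewrite (weyl_weight lt_in); apply: gradedM; last exact: graded_omega.
apply/graded_polyP; apply: mpoly_gradedD; last apply: mpoly_gradedN.
  by apply: mpoly_gradedXn; apply: mpoly_gradedX.
by apply: mpoly_gradedXn; apply: mpoly_gradedX.
Qed.

Lemma mpoly_graded_weyl_x i j : mpoly_graded u (weyl_x i j).
Proof.
rewrite /weyl_x; case: ifP => _; first exact: mpoly_gradedX.
by case: ifP => _; [apply: mpoly_gradedN|]; apply: mpoly_gradedX.
Qed.

Lemma graded_weyl i z p : graded z p -> graded z (weyl i p).
Proof.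
move=> /gradedP gp; rewrite /weyl /pext_subst; apply: graded_sum => S _.
rewrite -(subrK (\sum_(j in S) w j) z); apply: gradedM.
  by apply/graded_polyP/mpoly_graded_comp => // j; apply: mpoly_graded_weyl_x.
rewrite -big_enum /=; elim: (enum S) => [|j r IH].
  by rewrite !big_nil; apply: graded1.
by rewrite !big_cons; apply: gradedM => //; apply: graded_weyl_omega.
Qed.

(** Multiplication by [b] carries each homogeneous component into the next degree, so components
    cannot mix. *)
Lemma pihomog_mull k a b : b \is 1.-homog for mdeg ->
  pihomog mdeg k.+1 (b * a) = b * pihomog mdeg k a.
Proof.
(* [K] bounds the degrees in [a] and also exceeds [k], so that component [k] is a summand even when
   it vanishes. *)
move=> hb; pose K := maxn (msize a) k.+1.
rewrite [a in LHS](@pihomog_partitionE _ _ mdeg K a (leq_maxl _ _)).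
rewrite mulr_sumr (raddf_sum (pihomog mdeg k.+1)) /=.
have kK : (k < K)%N by rewrite leq_max leqnn orbT.
have hom d : b * pihomog mdeg d a \is d.+1.-homog for mdeg.
  by rewrite -add1n; apply: dhomogM => //; apply: pihomogP.
rewrite (bigD1 (Ordinal kK)) //= big1 => [|d]; first by rewrite addr0 pihomog_dE.
rewrite -val_eqE /= => nd; apply: pihomog_ne0 (hom d).
by rewrite eqSS.
Qed.

(** The weight need not determine the degree, since [u] may be 0, so the argument uses ordinary
    degrees: a monomial of degree [k] in [a] forces a nonzero component of degree [k.+1] in [b * a],
    the polynomial ring being a domain, and every monomial found there has weight [z]. *)
Lemma mpoly_graded_divX z a b : b != 0 -> b \is 1.-homog for mdeg ->
  mpoly_graded z (b * a) -> mpoly_graded (z - u) a.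
Proof.
move=> b0 hb gba m ma; set k := mdeg m.
have : pihomog mdeg k a != 0.
  apply/eqP => /(congr1 (mcoeff m)); rewrite pihomogE raddf_sum mcoeff0 /=.
  rewrite big_mkcond (bigD1_seq m) //= ?msupp_uniq // eqxx mcoeffZ mcoeffX eqxx.
  rewrite mulr1 big1 ?addr0 => [|m' nm]; last first.
    by case: ifP => _ //; rewrite mcoeffZ mcoeffX (negPf nm) mulr0.
  by apply/eqP; rewrite mcoeff_eq0 negbK.
rewrite -(inj_eq (mulfI b0)) mulr0 -pihomog_mull // => nz.
have [m' m'ba m'k] : exists2 m', m' \in msupp (b * a) & mdeg m' = k.+1.
  move: nz; rewrite pihomogE; apply: contra_neqP => nex.
  rewrite big_seq_cond big_pred0 // => m'; apply/negP => /andP[h /eqP e].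
  by apply: nex; exists m'.
by rewrite -(gba m' m'ba) m'k mulrS addrAC subrr add0r.
Qed.

(** [weyl i] preserves weights, and the quotient is taken coefficientwise by the nonzero linear form
    x_i - s_i(x_i). *)
Lemma graded_demazure i z p : graded z p -> graded (z - u) (demazure i p).
Proof.
move=> gp; apply/gradedP => S; rewrite addrAC.
apply: (@mpoly_graded_divX _ _ ('X_i - weyl_x i i)).
- exact: demazure_den_neq0.
- apply/dhomogP => m /msuppD_le; rewrite mem_cat => /orP[|].
    by rewrite msuppX inE => /eqP->; rewrite /= mdeg1.
  rewrite (perm_mem (msuppN _)) /weyl_x eqxx; case: ifP => _.
    by rewrite msuppX inE => /eqP->; rewrite /= mdeg1.
  by rewrite (perm_mem (msuppN _)) msuppX inE => /eqP->; rewrite /= mdeg1.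
- rewrite -polyP_mulE polyPB -weyl_X demazureP.
  by move: S; apply/gradedP/gradedD => //; apply/gradedN/graded_weyl.
Qed.

End Grading.

Definition omega_deg n (i : 'I_n) : int := - (2 * i.+1)%N%:Z.

Lemma omega_deg_weyl n : weyl_grading 1 (@omega_deg n).
Proof. by move=> i lt_in; rewrite /omega_deg /= modn_small // !PoszM; ring. Qed.

Lemma homog_graded n d (p : Pext n) :
  pext_homog d p <-> graded (1 : int) (@omega_deg n) d p.
Proof.
have e (S : {set 'I_n}) (m : 'X_{1..n}) : (1 : int) *+ mdeg m + \sum_(i in S) omega_deg i =
    (mdeg m)%:Z - (\sum_(i in S) 2 * i.+1)%N%:Z.
  by rewrite natz sumrN (big_morph Posz PoszD (erefl _)).
by split=> h S m /h; rewrite e.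
Qed.

(** Addition in [bool] is exclusive or, so the weight of omega_S is the parity of [#|S|]. *)
Lemma parity_graded n e (p : Pext n) :
  pext_parity e p <-> graded (0 : bool) (fun _ : 'I_n => true) e p.
Proof.
have h (S : {set 'I_n}) (m : 'X_{1..n}) :
    (0 : bool) *+ mdeg m + \sum_(i in S) true = odd #|S|.
  rewrite mul0rn add0r big_const.
  by elim: #|S| => //= k ->.
split=> gp S => [m mp|].
  by rewrite h gp // -msupp_eq0; case: (msupp _) mp.
by rewrite -msupp_eq0; case E: (msupp _) => [|m r] // _; rewrite -(gp S m) ?h // E mem_head.
Qed.

(** * Operators and super-linearity *)

Definition op_graded n (Z : zmodType) (u : Z) (w : 'I_n -> Z) z (f : linop n) :=
  forall y p, graded u w y p -> graded u w (y + z) (f p).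

Section OpGrading.
Variables (n : nat) (Z : zmodType) (u : Z) (w : 'I_n -> Z).
Implicit Types (f g : linop n) (z : Z).

Lemma op_graded_lmul z (p : Pext n) :
  graded u w z p -> op_graded u w z (lmul_op p).
Proof. by move=> gp y q gq; rewrite addrC; apply: gradedM. Qed.

Lemma op_gradedM y z f g :
  op_graded u w y f -> op_graded u w z g -> op_graded u w (y + z) (f * g).
Proof. by move=> gf gg x p gp; rewrite (addrC y) addrA; apply/gf/gg. Qed.

Lemma op_gradedD z f g :
  op_graded u w z f -> op_graded u w z g -> op_graded u w z (f + g).
Proof. by move=> gf gg y p gp; apply: gradedD; [apply: gf | apply: gg]. Qed.

Lemma op_gradedN z f : op_graded u w z f -> op_graded u w z (- f).
Proof. by move=> gf y p gp; apply/gradedN/gf. Qed.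

Lemma op_graded_sum I (r : seq I) (P : pred I) z F :
  (forall i, P i -> op_graded u w z (F i)) ->
  op_graded u w z (\sum_(i <- r | P i) F i).
Proof.
move=> gF; elim/big_rec: _ => [y p gp|i f /gF gi gf]; first exact: graded0.
exact: op_gradedD.
Qed.

End OpGrading.

Lemma op_homog_graded n d (f : linop n) :
  op_homog d f <-> op_graded 1 (@omega_deg n) d f.
Proof. by split=> hf k p /homog_graded/hf/homog_graded. Qed.

Lemma op_parity_graded n e (f : linop n) :
  op_parity e f <-> op_graded (0 : bool) (fun _ => true) e f.
Proof. by split=> hf k p /parity_graded/hf/parity_graded. Qed.

(* Even and of degree k, expressed uniformly for all Weyl-invariant gradings:
   the Z-grading and the parity are both instances. *)
Definition op_degree n (k : int) (f : linop n) :=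
  forall (Z : zmodType) (u : Z) w, weyl_grading u w -> op_graded u w (u *~ k) f.

Lemma parity_weyl_grading n : weyl_grading (0 : bool) (fun _ : 'I_n => true).
Proof. by move=> i _; rewrite mul0rn add0r. Qed.

Lemma op_degree_parity n k (f : linop n) : op_degree k f -> op_parity false f.
Proof.
by move=> /(_ _ _ _ (@parity_weyl_grading n)); rewrite mul0rz => /op_parity_graded.
Qed.

Lemma op_degree1 n : op_degree 0 (1 : linop n).
Proof. by move=> Z u w _ y p; rewrite mulr0z addr0. Qed.

Lemma op_degreeM n j k (f g : linop n) :
  op_degree j f -> op_degree k g -> op_degree (j + k) (f * g).
Proof.
by move=> hf hg Z u w uw; rewrite mulrzDr; apply: op_gradedM; [apply: hf | apply: hg].
Qed.

Lemma op_degreeB n k (f g : linop n) :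
  op_degree k f -> op_degree k g -> op_degree k (f - g).
Proof.
move=> hf hg Z u w uw; apply: op_gradedD; first exact: hf.
by apply/op_gradedN/hg.
Qed.

Lemma op_degree_sum n I (r : seq I) (P : pred I) k (F : I -> linop n) :
  (forall i, P i -> op_degree k (F i)) -> op_degree k (\sum_(i <- r | P i) F i).
Proof. by move=> hF Z u w uw; apply: op_graded_sum => i /hF; apply. Qed.

Lemma op_degree_demazure n (i : 'I_n) : op_degree (-1) (demazure_op i).
Proof. by move=> Z u w uw y p; rewrite mulrN1z; apply: graded_demazure. Qed.

Lemma op_degree_lmulXn n (i : 'I_n) k :
  op_degree k%:Z (lmul_op (polyP ('X_i ^+ k))).
Proof.
move=> Z u w uw; apply/op_graded_lmul/graded_polyP.
by rewrite -pmulrn; apply/mpoly_gradedXn/mpoly_gradedX.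
Qed.

Lemma linop_sumE n I (r : seq I) (P : pred I) (F : I -> linop n) p :
  (\sum_(i <- r | P i) F i) p = \sum_(i <- r | P i) F i p.
Proof. by elim/big_rec2: _ => // i y1 y2 _ <-. Qed.

Lemma linop_subE n (f g : linop n) p : (f - g) p = f p - g p.
Proof. by []. Qed.

Lemma in_NH1 n : in_NH (1 : linop n).
Proof. by have [/asboolP] := NH_pred_subalg n. Qed.

Lemma in_NHB n (f g : linop n) : in_NH f -> in_NH g -> in_NH (f - g).
Proof. by move=> hf hg; rewrite addrC -scaleN1r; apply: in_NH_linear. Qed.

Lemma in_NH_sum n I (r : seq I) (P : pred I) (F : I -> linop n) :
  (forall i, P i -> in_NH (F i)) -> in_NH (\sum_(i <- r | P i) F i).
Proof.
move=> hF; elim/big_ind: _ => // [|f g hf hg].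
  by rewrite -(subrr 1); apply: in_NHB; apply: in_NH1.
by rewrite -(scale1r f); apply: in_NH_linear.
Qed.

(** * Parity components, supercommutativity and right linearity *)

Definition parity_part n (e : bool) (p : Pext n) : Pext n :=
  [ffun S : {set 'I_n} => if odd #|S| == e then p S else 0].

Section Super.
Variable n : nat.
Implicit Types (p q l m : Pext n) (b c e : bool) (f g : linop n).

Lemma parity_part_parity e p : pext_parity e (parity_part e p).
Proof. by move=> S; rewrite ffunE; case: (eqVneq (odd #|S|) e) => // _; rewrite eqxx. Qed.

Lemma parity_partD p : p = parity_part false p + parity_part true p.
Proof.
by apply/ffunP => S; rewrite pext_addE !ffunE; case: odd; rewrite ?addr0 ?add0r.
Qed.

Lemma parity_part_sum p q p' q' :
  pext_parity false p -> pext_parity true q ->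
  pext_parity false p' -> pext_parity true q' ->
  p + q = p' + q' -> p = p' /\ q = q'.
Proof.
have vanish e (r : Pext n) (S : {set 'I_n}) : pext_parity e r -> odd #|S| != e -> r S = 0.
  by move=> hr; apply: contraNeq => /hr ->.
move=> hp hq hp' hq' /ffunP epq.
split; apply/ffunP => S; have := epq S; rewrite !pext_addE;
  case oS: (odd #|S|).
- by rewrite (vanish _ _ _ hp) ?(vanish _ _ _ hp') ?oS.
- by rewrite (vanish _ _ _ hq) ?(vanish _ _ _ hq') ?oS // !addr0.
- by rewrite (vanish _ _ _ hp) ?(vanish _ _ _ hp') ?oS // !add0r.
- by rewrite (vanish _ _ _ hq) ?(vanish _ _ _ hq') ?oS.
Qed.

Lemma parity_weyl i e p : pext_parity e p -> pext_parity e (weyl i p).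
Proof.
move=> /parity_graded gp; apply/parity_graded; apply: graded_weyl gp.
exact: parity_weyl_grading.
Qed.

(** [weyl i] preserves parity, so the equation s_i(l) = l splits into one equation for each
    component. *)
Lemma Lam_parity_part e l : l \in Lam_pred n -> parity_part e l \in Lam_pred n.
Proof.
move=> /Lam_predP hl; apply/Lam_predP => i; have := hl i.
rewrite {1 2}(parity_partD l) raddfD /= => /parity_part_sum[||||e0 e1];
  try by [apply: parity_part_parity | apply/parity_weyl/parity_part_parity].
by case: e.
Qed.

(** For disjoint [S] and [T] each pair of elements is inverted in exactly one of the two orders, so
    the inversion counts add up to [#|S| * #|T|]. *)
Lemma wedge_signC (S T : {set 'I_n}) :
  wedge_sign S T = (-1) ^+ (odd #|S| && odd #|T|) * wedge_sign T S.
Proof.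
rewrite /wedge_sign disjoint_sym; case: ifP => [dTS|_]; last by rewrite mulr0.
rewrite -oddM signr_odd -exprD.
have -> : (#|S| * #|T| = inversions S T + inversions T S)%N.
  rewrite /inversions [X in (_ + X)%N]exchange_big /= -big_split /= -sum_nat_const.
  apply: eq_bigr => s sS; rewrite -big_split /= -sum1_card.
  apply: eq_bigr => t tT; case: ltngtP => // /val_inj ets.
  by move: dTS; rewrite disjoint_sym => /disjointFr/(_ sS); rewrite -ets tT.
by rewrite -addnA -[RHS]signr_odd !oddD addbb addbF signr_odd.
Qed.

Lemma supercommute b c p q : pext_parity b p -> pext_parity c q ->
  p * q = (-1) ^+ (b && c) * (q * p).
Proof.
move=> hp hq.
(* As a rational scalar the sign can be moved inside the sums. *)
have -> x : (-1) ^+ (b && c) * x = (-1 : rat) ^+ (b && c) *: x.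
  by case: (b && c); rewrite ?(scaleN1r, scale1r, mulN1r, mul1r).
apply/ffunP => U; rewrite pext_scaleE !pext_mulE.
rewrite [in RHS](exchange_big_dep predT) //= scaler_sumr.
apply: eq_bigr => S _; rewrite scaler_sumr; apply: eq_big => [T|T _]; first by rewrite setUC.
have [->|/hp <-] := eqVneq (p S) 0; first by rewrite !(mul0r, mulr0) scaler0.
have [->|/hq <-] := eqVneq (q T) 0; first by rewrite !(mul0r, mulr0) scaler0.
rewrite wedge_signC; case: (_ && _); rewrite ?scaleN1r ?scale1r; ring.
Qed.

(** The sign-free form of superlinearity; it makes sense without splitting [f] by parity. *)
Definition Lam_rlinear f := forall p l, l \in Lam_pred n -> f (p * l) = f p * l.

Lemma Lam_rlinear_demazure i : Lam_rlinear (demazure_op i).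
Proof.
move=> p l /Lam_predP hl; apply: (@demazure_den_reg _ i).
by rewrite [RHS]mulrA !demazureP rmorphM /= hl mulrBl.
Qed.

Lemma NH_rlinear f : in_NH f -> Lam_rlinear f.
Proof.
elim=> [q p l _|i|c g h _ IHg _ IHh p l hl|g h _ IHg _ IHh p l hl].
- by rewrite /= mulrA.
- exact: Lam_rlinear_demazure.
- by rewrite !linop_addE !linop_scaleE IHg // IHh // mulrDl scalerAl.
- by rewrite !linop_mulE IHh // IHg.
Qed.

(** Moving [l] to the right of [m], through [f], and back to the left of [f m] costs the sign
    exponent |l||m| + |l|(|f| + |m|), which is |f||l| modulo 2. Only [m] has to be split by
    parity. *)
Lemma superlinear_of_rlinear e f :
  op_parity e f -> Lam_rlinear f -> superlinear e f.
Proof.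
move=> pf rf; split=> // b l m hl hb.
rewrite [m in LHS](parity_partD m) [m in RHS](parity_partD m) mulrDr !raddfD /= !mulrDr.
have part c : f (l * parity_part c m) = (-1) ^+ (e && b) * (l * f (parity_part c m)).
  rewrite (supercommute hb (@parity_part_parity c m)) !mulr_sign.
  rewrite (supercommute hb (pf _ _ (@parity_part_parity c m))) !mulr_sign.
  rewrite (fun_if f) raddfN /= rf //.
  by case: (e); case: (b); case: c; rewrite //= ?opprK.
by rewrite !part.
Qed.

(** The same sign count in reverse; [l] is split as well, its components remaining in
    [Lam_pred n]. *)
Lemma rlinear_of_superlinear e f : superlinear e f -> Lam_rlinear f.
Proof.
move=> [pf sf] p l hl; rewrite (parity_partD p) (parity_partD l).
have part b c : f (parity_part c p * parity_part b l) =
    f (parity_part c p) * parity_part b l.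
  have hb := @parity_part_parity b l; have hc := @parity_part_parity c p.
  rewrite (supercommute hc hb) !mulr_sign.
  rewrite (supercommute (pf _ _ hc) hb) !mulr_sign.
  rewrite (fun_if f) raddfN /= (sf b) ?Lam_parity_part // mulr_sign.
  by case: (e); case: (b); case: (c); rewrite //= ?opprK.
by rewrite !(mulrDl, mulrDr, raddfD) /= !part addrACA.
Qed.

Lemma EndLam_rlinear f : f \in EndLam_pred n -> Lam_rlinear f.
Proof.
move=> /asboolP[f0 [f1 [/rlinear_of_superlinear h0 /rlinear_of_superlinear h1 ->]]].
by move=> p l hl; rewrite !linop_addE h0 // h1 // mulrDl.
Qed.

Lemma op_parity_lmul e p : pext_parity e p -> op_parity e (lmul_op p).
Proof. by move=> /parity_graded hp; apply/op_parity_graded/op_graded_lmul. Qed.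

(** A multiplication operator splits along the parity of its multiplier, a Demazure operator is
    even, and [EndLam_pred n] is a subalgebra. *)
Lemma NH_sub_EndLam f : in_NH f -> f \in EndLam_pred n.
Proof.
elim=> [p|i|c g h _ hg _ hh|g h _ hg _ hh].
- apply/asboolP; exists (lmul_op (parity_part false p)), (lmul_op (parity_part true p)).
  split; last by apply: linopP => q; rewrite linop_addE /= -mulrDl -parity_partD.
    apply: superlinear_of_rlinear; first exact/op_parity_lmul/parity_part_parity.
    exact/NH_rlinear/in_NH_mul.
  apply: superlinear_of_rlinear; first exact/op_parity_lmul/parity_part_parity.
  exact/NH_rlinear/in_NH_mul.
- apply/asboolP; exists (demazure_op i), 0; split; last by rewrite addr0.
    apply: superlinear_of_rlinear; last exact: Lam_rlinear_demazure.
    by apply: op_degree_parity; apply: op_degree_demazure.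
  apply: superlinear_of_rlinear => [b p _ S|p l _]; last by rewrite [RHS]mul0r.
  by rewrite [(0 : linop n) p]/= pext_0E eqxx.
- by have [_ + _] := EndLam_pred_subalg n; apply.
- by have [_ _ +] := EndLam_pred_subalg n; apply.
Qed.

End Super.

(** * Reading off coefficients with Demazure operators *)

(* The divided difference of t ^ a on the nodes s; it is 0 when s is empty. *)
Fixpoint pow_dd (R : nzRingType) (s : seq R) : nat -> R :=
  if s is r :: s' then
    fix dd a := if a is a'.+1 then r * dd a' + pow_dd s' a' else (nilp s')%:R
  else fun=> 0.

Arguments pow_dd : simpl never.

Section DividedDifferences.
Variable R : idomainType.
Implicit Types (u v r : R) (s t : seq R) (a : nat).

Lemma pow_dd_nil a : pow_dd [::] a = 0 :> R. Proof. by []. Qed.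

Lemma pow_dd0 r s : pow_dd (r :: s) 0 = (nilp s)%:R. Proof. by []. Qed.

Lemma pow_ddS r s a : pow_dd (r :: s) a.+1 = r * pow_dd (r :: s) a + pow_dd s a.
Proof. by []. Qed.

(** The usual recursion for divided differences, freed of its denominator. *)
Lemma pow_dd_diff u v s a :
  (u - v) * pow_dd [:: u, v & s] a = pow_dd (u :: s) a - pow_dd (v :: s) a.
Proof.
elim: a => [|a IH]; first by rewrite !pow_dd0 mulr0 subrr.
rewrite pow_ddS mulrDr mulrCA IH 2!pow_ddS; ring.
Qed.

Lemma pow_dd_swap u v s : pow_dd [:: u, v & s] =1 pow_dd [:: v, u & s].
Proof.
move=> a; have [->//|] := eqVneq u v; rewrite -subr_eq0 => /mulfI; apply.
by rewrite pow_dd_diff -[u - v]opprB mulNr pow_dd_diff opprB.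
Qed.

(** Prepending nodes sees the tail only through its divided differences and through its emptiness,
    which decides the value at exponent 0. *)
Lemma pow_dd_cat s t t' : pow_dd t =1 pow_dd t' -> (nilp t = nilp t') ->
  pow_dd (s ++ t) =1 pow_dd (s ++ t').
Proof.
move=> ett' ntt'; elim: s => //= r s IH a.
have nE : nilp (s ++ t) = nilp (s ++ t').
  by move: ntt'; rewrite /nilp !size_cat !addn_eq0 => ->.
by elim: a => [|a IHa]; rewrite ?pow_dd0 ?nE // !pow_ddS IHa IH.
Qed.

Lemma pow_dd1 r a : pow_dd [:: r] a = r ^+ a.
Proof. by elim: a => // a IH; rewrite pow_ddS IH pow_dd_nil addr0 exprS. Qed.

(** A divided difference of order above the degree vanishes; at order equal to the degree it is the
    leading coefficient, here 1. *)
Lemma pow_dd_small s a : (a < size s)%N -> pow_dd s a = (a.+1 == size s)%:R.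
Proof.
elim: s a => // r s IH; elim=> [_|a IHa]; first by rewrite pow_dd0 /nilp eqSS eq_sym.
rewrite pow_ddS /= ltnS => lt_as; rewrite IHa ?ltnS 1?ltnW // IH //=.
by rewrite !eqSS (ltn_eqF lt_as) mulr0 add0r.
Qed.

End DividedDifferences.

Lemma pow_dd_map (R S : idomainType) (f : {rmorphism R -> S}) (s : seq R) a :
  f (pow_dd s a) = pow_dd (map f s) a.
Proof.
elim: s a => [|r s IH] a; first exact: raddf0.
elim: a => [|a IHa]; first by rewrite /= !pow_dd0 rmorph_nat /nilp size_map.
by rewrite pow_ddS rmorphD rmorphM IHa IH.
Qed.

Definition weyl_poly n (i : 'I_n) : {mpoly rat[n]} -> {mpoly rat[n]} :=
  comp_mpoly [tuple weyl_x i j | j < n].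

HB.instance Definition _ n (i : 'I_n) :=
  GRing.RMorphism.copy (weyl_poly i) (comp_mpoly [tuple weyl_x i j | j < n]).

Definition invariant_from n m (p : Pext n) :=
  forall i : 'I_n, (m <= i)%N -> weyl i p = p.

Section CoefOperators.
Variable n' : nat.
Local Notation n := n'.+1.
Implicit Types (i : 'I_n) (p q : Pext n).

Lemma weyl_polyP i a : weyl i (polyP a) = polyP (weyl_poly i a).
Proof. exact: pext_subst_polyP. Qed.

Definition xn (j : nat) : {mpoly rat[n]} := 'X_(inord j).

Lemma weyl_poly_xn i j : (j < n)%N -> j != i -> j != i.+1 -> weyl_poly i (xn j) = xn j.
Proof.
move=> jn ji jSi; rewrite /weyl_poly /xn comp_mpolyXU -tnth_nth tnth_mktuple /weyl_x.
case: ifP => [lt_in|_]; last first.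
  by case: eqP => // /(congr1 val); rewrite /= inordK // => /eqP; rewrite (negPf ji).
rewrite tpermD // -val_eqE /= inordK // eq_sym //.
by rewrite modn_small.
Qed.

Lemma weyl_poly_xnl i : (i.+1 < n)%N -> weyl_poly i (xn i) = xn i.+1.
Proof.
move=> lt_in; rewrite /weyl_poly /xn comp_mpolyXU -tnth_nth tnth_mktuple /weyl_x lt_in.
rewrite inord_val tpermL; congr 'X_ _; apply: val_inj => /=.
by rewrite inordK // modn_small.
Qed.

Lemma weyl_poly_xnr i : (i.+1 < n)%N -> weyl_poly i (xn i.+1) = xn i.
Proof.
move=> lt_in; rewrite /weyl_poly /xn comp_mpolyXU -tnth_nth tnth_mktuple /weyl_x lt_in.
rewrite (_ : inord i.+1 = ordS i) ?tpermR ?inord_val //.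
by apply: val_inj; rewrite /= inordK // modn_small.
Qed.

Lemma weyl_poly_xn_last i : i = n' :> nat -> weyl_poly i (xn i) = - xn i.
Proof.
move=> ein; rewrite /weyl_poly /xn comp_mpolyXU -tnth_nth tnth_mktuple /weyl_x.
by rewrite {1}ein ltnn inord_val eqxx.
Qed.

(** Subtracting the image under s_i compares the divided differences with first node [u] and with
    first node s_i(u); dividing by u - s_i(u) then adjoins s_i(u) as a new node. The first
    hypothesis allows u = x_i and, for i not last, also u = -x_(i+1). *)
Lemma demazure_pow_dd i u (s : seq {mpoly rat[n]}) a p :
  u - weyl_poly i u = xn i - weyl_poly i (xn i) ->
  pow_dd (map (weyl_poly i) s) =1 pow_dd s ->
  weyl i p = p ->
  demazure i (polyP (pow_dd (u :: s) a) * p) =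
  polyP (pow_dd [:: weyl_poly i u, u & s] a) * p.
Proof.
move=> eu es ep; apply: (@demazure_den_reg _ i).
rewrite demazureP rmorphM /= ep weyl_polyP mulrA weyl_polyP -polyPB.
rewrite -[X in 'X_X](inord_val i) -/(xn i) -eu.
rewrite -polyPM -[u - _]opprB mulNr pow_dd_diff opprB -mulrBl -polyPB; congr (polyP (_ - _) * _).
rewrite pow_dd_map /=.
have:= @pow_dd_cat _ [:: weyl_poly i u] _ _ es; apply.
by rewrite /nilp size_map.
Qed.

Lemma rev_iotaS m t : rev (iota m t.+1) = (m + t)%N :: rev (iota m t).
Proof. by rewrite -addn1 iotaD rev_cat. Qed.

Lemma map_weyl_poly_xn i (s : seq nat) (f : {mpoly rat[n]} -> {mpoly rat[n]}) :
  (forall a, weyl_poly i (f a) = f (weyl_poly i a)) ->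
  (forall j, j \in s -> [&& (j < n)%N, j != i & j != i.+1]) ->
  map (weyl_poly i) [seq f (xn j) | j <- s] = [seq f (xn j) | j <- s].
Proof.
move=> fC hs; rewrite -map_comp; apply/eq_in_map => j /hs /and3P[jn ji jSi] /=.
by rewrite fC weyl_poly_xn.
Qed.

(** First half of the palindromic word: s_m, ..., s_(m+t-1) successively adjoin the nodes x_(m+1),
    ..., x_(m+t). *)
Lemma pow_dd_ascending m t : (m + t < n)%N ->
  exists E : linop n, [/\ in_NH E, op_degree (- t%:Z) E
    & forall a p, invariant_from m p -> E (polyP (xn m ^+ a) * p) =
        polyP (pow_dd [seq xn j | j <- rev (iota m t.+1)] a) * p].
Proof.
elim: t => [_|t IH mt].
  exists 1; split; [|exact: op_degree1|].
  - by have [/asboolP] := NH_pred_subalg n.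
  - by move=> a p _; rewrite /= pow_dd1.
have [|E [hE dE eE]] := IH; first by apply: leq_trans mt; lia.
pose i : 'I_n := inord (m + t).
have vi : i = (m + t)%N :> nat by rewrite inordK //; lia.
have xnS : weyl_poly i (xn i) = xn i.+1 by rewrite weyl_poly_xnl // vi; lia.
exists (demazure_op i * E); split.
- exact: in_NH_comp (in_NH_demazure i) hE.
- rewrite (_ : - _ = -1 + - t%:Z); last by lia.
  by apply: op_degreeM dE; apply: op_degree_demazure.
- move=> a p hp; rewrite linop_mulE eE // !rev_iotaS addnS -vi /=.
  rewrite demazure_pow_dd ?xnS ?hp //; last by rewrite vi leq_addr.
  move=> b; rewrite (map_weyl_poly_xn (f := id)) // => j; rewrite mem_rev mem_iota vi; lia.
Qed.

(** Second half of the word: s_(n-1), ..., s_(n-t) successively adjoin the nodes -x_(n-1), ...,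
    -x_(n-t). *)
Lemma pow_dd_descending m t : (0 < t)%N -> (m + t <= n)%N ->
  exists E : linop n, [/\ in_NH E, op_degree (- (n' - m + t)%N%:Z) E
    & forall a p, invariant_from m p -> E (polyP (xn m ^+ a) * p) =
        polyP (pow_dd ([seq - xn j | j <- iota (n - t) t] ++
                       [seq xn j | j <- rev (iota m (n - m))]) a) * p].
Proof.
elim: t => // t IH _ mt; pose i : 'I_n := inord (n' - t).
have vi : i = (n' - t)%N :> nat by rewrite inordK //; lia.
have split_iota : iota m (n - m) = iota m (i - m) ++ iota i (n - i).
  by rewrite -{2}(@subnKC m i) -?iotaD; [congr iota|]; lia.
case: t => [|t] in IH mt i vi split_iota *.
  (* The turning point: here [i] is the last index, and its reflection negates the leading node
     x_(n-1). *)
  have [|E [hE dE eE]] := @pow_dd_ascending m (n' - m); first by lia.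
  exists (demazure_op i * E); split.
  - exact: in_NH_comp (in_NH_demazure i) hE.
  - rewrite (_ : - _ = -1 + - (n' - m)%N%:Z); last by lia.
    by apply: op_degreeM dE; apply: op_degree_demazure.
  - move=> a p hp; rewrite linop_mulE eE // (_ : n - m = (n' - m).+1)%N; last by lia.
    rewrite !rev_iotaS /= (_ : m + (n' - m) = i)%N; last by lia.
    rewrite demazure_pow_dd ?hp //; last by lia.
      by rewrite (_ : (n - 1)%N = i) ?weyl_poly_xn_last //; lia.
    move=> b; rewrite (map_weyl_poly_xn (f := id)) // => j; rewrite mem_rev mem_iota; lia.
(* Now the leading node is -x_(i+1), sent to -x_i. The reflection also exchanges x_(i+1) and x_i
   further down the list; they are adjacent there, so [pow_dd_swap] absorbs the exchange. *)
have [|E [hE dE eE]] := IH isT; first by lia.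
have lt_in : (i.+1 < n)%N by lia.
exists (demazure_op i * E); split.
- exact: in_NH_comp (in_NH_demazure i) hE.
- rewrite (_ : - _ = -1 + - (n' - m + t.+1)%N%:Z); last by lia.
  by apply: op_degreeM dE; apply: op_degree_demazure.
- move=> a p hp; rewrite linop_mulE eE //=.
  rewrite (_ : n - t.+1 = i.+1)%N; last by lia.
  rewrite (_ : n - t.+2 = i)%N; last by lia.
  have xnS : weyl_poly i (- xn i.+1) = - xn i by rewrite rmorphN /= weyl_poly_xnr.
  rewrite demazure_pow_dd ?xnS ?hp //; last by lia.
    by rewrite weyl_poly_xnl // opprK addrC.
  move=> b; rewrite map_cat map_weyl_poly_xn; first last.
  + by move=> j; rewrite mem_iota; lia.
  + by move=> c; rewrite rmorphN.
  rewrite split_iota (_ : n - i = t.+2)%N; last by lia.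
  rewrite rev_cat /= !rev_cons -!cats1 -!catA /= !map_cat /=.
  rewrite (map_weyl_poly_xn (f := id)) //; last first.
    by move=> j; rewrite mem_rev mem_iota; lia.
  rewrite (map_weyl_poly_xn (f := id)) //; last first.
    by move=> j; rewrite mem_rev mem_iota; lia.
  rewrite weyl_poly_xnl // weyl_poly_xnr //.
  apply: pow_dd_cat; last by rewrite /nilp !size_cat.
  by apply: pow_dd_cat; first exact: pow_dd_swap.
Qed.

(** The whole word produces 2(n - m) nodes, so only the largest admissible exponent survives. *)
Lemma top_coef_operator m : (m < n)%N ->
  exists E : linop n, [/\ in_NH E, op_degree (- (2 * (n - m)).-1%:Z) E
    & forall a p, (a < 2 * (n - m))%N -> invariant_from m p ->
        E (polyP (xn m ^+ a) * p) = if a.+1 == (2 * (n - m))%N then p else 0].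
Proof.
move=> mn; have [||E [hE dE eE]] := @pow_dd_descending m (n - m); try lia.
exists E; split=> //; first by move: dE; congr (op_degree (- _%:Z) E); lia.
move=> a p lt_a hp; rewrite eE // pow_dd_small.
  rewrite size_cat !size_map size_rev !size_iota addnn -mul2n.
  by case: eqP => _; rewrite ?rmorph1 ?raddf0 ?mul1r ?mul0r.
by rewrite size_cat !size_map size_rev !size_iota addnn -mul2n.
Qed.

(** Downward induction on [j]: remove the terms with exponent above [j] by the operators already
    built, multiply by x_m^(K-1-j) to bring exponent [j] to the top, then apply [E]. *)
Lemma coef_operator m j : (m < n)%N -> (j < 2 * (n - m))%N ->
  exists C : linop n, [/\ in_NH C, op_degree (- j%:Z) C
    & forall k p, (k < 2 * (n - m))%N -> invariant_from m p ->
        C (polyP (xn m ^+ k) * p) = if k == j then p else 0].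
Proof.
move=> mn; have [E [hE dE eE]] := top_coef_operator mn.
set K := (2 * (n - m))%N in dE eE *.
have [t] := ubnP (K - j); elim: t j => // t IH j lt_t lt_jK.
(* The induction hypothesis supplies [C i] only for i > j; the value 0 below is a filler. *)
have /choice[C hC] : forall i : 'I_K, exists C : linop n, (j < i)%N ->
    [/\ in_NH C, op_degree (- i%:Z) C & forall k p, (k < K)%N -> invariant_from m p ->
        C (polyP (xn m ^+ k) * p) = if k == i then p else 0].
  move=> i; case: (ltnP j i) => ji; last by exists 0.
  have [||C hC] := IH i; [lia | exact: ltn_ord |].
  by exists C.
pose x k : linop n := lmul_op (polyP (xn m ^+ k)).
exists (E * x (K.-1 - j)%N * (1 - \sum_(i < K | (j < i)%N) x i * C i)); split.
- apply: in_NH_comp; first exact: in_NH_comp hE (in_NH_mul _).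
  apply: in_NHB; first exact: in_NH1.
  by apply: in_NH_sum => i ji; apply: in_NH_comp; [exact: in_NH_mul | have [] := hC i ji].
- rewrite (_ : - j%:Z = - K.-1%:Z + (K.-1 - j)%N%:Z + 0); last by lia.
  apply: op_degreeM; first by apply: op_degreeM dE _; apply: op_degree_lmulXn.
  apply: op_degreeB; first exact: op_degree1.
  apply: op_degree_sum => i ji; rewrite -(subrr (i : nat)%:Z).
  by apply: op_degreeM; [apply: op_degree_lmulXn | have [] := hC i ji].
move=> k p lt_kK hp; rewrite 2!linop_mulE.
have -> : (1 - \sum_(i < K | (j < i)%N) x i * C i) (polyP (xn m ^+ k) * p) =
    if (k <= j)%N then polyP (xn m ^+ k) * p else 0.
  rewrite linop_subE linop_oneE.
  rewrite linop_sumE (eq_bigr (fun i : 'I_K => if i == k :> nat then polyP (xn m ^+ k) * p else 0)).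
    rewrite -big_mkcondr; case: leqP => [kj|jk].
      by rewrite big_pred0 ?subr0 // => i; apply/negP => /andP[+ /eqP eik]; lia.
    rewrite (big_pred1 (Ordinal lt_kK)) ?subrr // => i.
    by rewrite /= -val_eqE /=; case: eqP => [->|]; rewrite ?jk ?andbF.
  move=> i ji; have [_ _ eC] := hC i ji; rewrite linop_mulE eC //= eq_sym.
  by case: eqP => [->|] //; rewrite mulr0.
case: leqP => [kj|jk]; last by rewrite !raddf0; case: eqP => // ekj; lia.
rewrite /= mulrA -polyPM -exprD eE //; last by lia.
by congr (if _ then _ else _); apply/eqP/eqP; lia.
Qed.

End CoefOperators.

(** * Spanning by staircase monomials *)

Section Spanning.
Variable n' : nat.
Local Notation n := n'.+1.
Local Notation x := (@xn n').
Implicit Types (i : 'I_n) (p q : Pext n).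

Lemma weyl_poly_sqr i j : (j < n)%N -> (i.+1 == n) || (j != i) && (j != i.+1) ->
  weyl_poly i (x j ^+ 2) = x j ^+ 2.
Proof.
move=> jn /orP[/eqP[ein]|/andP[ji jSi]]; rewrite rmorphXn /=; last by rewrite weyl_poly_xn.
have [->|ji] := eqVneq j i; first by rewrite weyl_poly_xn_last // sqrrN.
by rewrite weyl_poly_xn //; lia.
Qed.

(** The last reflection fixes every square; any other permutes x_0^2, ..., x_(j-1)^2 unless it
    exchanges x_(j-1) with x_j. [G] is left general to serve both factors X + x_k^2 and X -
    x_k^2. *)
Lemma prod_weyl_poly_sqr (T : comNzRingType) (G : {mpoly rat[n]} -> T) i j :
  (j <= n)%N -> (i.+1 == n) || (j != i.+1) ->
  \prod_(0 <= k < j) G (weyl_poly i (x k ^+ 2)) = \prod_(0 <= k < j) G (x k ^+ 2).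
Proof.
move=> jn ij; have [ein|nin] := eqVneq i.+1 n.
  by apply: eq_big_nat => k /andP[_ kj]; rewrite weyl_poly_sqr ?ein ?eqxx //; lia.
have lt_in : (i.+1 < n)%N by have := ltn_ord i; lia.
have [ji|ij'] := leqP j i.
  by apply: eq_big_nat => k /andP[_ kj]; rewrite weyl_poly_sqr //; lia.
have split_prod (H : nat -> T) : \prod_(0 <= k < j) H k =
    \prod_(0 <= k < i) H k * (H i * (H i.+1 * \prod_(i.+2 <= k < j) H k)).
  rewrite (@big_cat_nat _ _ _ i) //=; last exact: ltnW.
  by rewrite (@big_ltn _ _ _ i) // (@big_ltn _ _ _ i.+1) //; lia.
rewrite !split_prod !rmorphXn /= weyl_poly_xnl // weyl_poly_xnr //.
congr (_ * _).
  by apply: eq_big_nat => k /andP[_ kj]; rewrite weyl_poly_sqr //; lia.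
rewrite mulrCA; congr (_ * (_ * _)).
by apply: eq_big_nat => k /andP[ik kj]; rewrite weyl_poly_sqr //; lia.
Qed.

Definition sqr_tail m : {poly {mpoly rat[n]}} := \prod_(m <= j < n) ('X - (x j ^+ 2)%:P).

(** Its coefficient of X^k is the elementary symmetric polynomial e_(j-k)(x_0^2, ..., x_(j-1)^2). *)
Definition sqr_head j : {poly {mpoly rat[n]}} := \prod_(0 <= k < j) ('X + (x k ^+ 2)%:P).

Lemma map_sqr_head i j : (j <= n)%N -> (i.+1 == n) || (j != i.+1) ->
  map_poly (weyl_poly i) (sqr_head j) = sqr_head j.
Proof.
move=> jn ij; rewrite rmorph_prod /= -[RHS](@prod_weyl_poly_sqr _ (fun a => 'X + a%:P) i j jn ij).
by apply: eq_bigr => k _; rewrite rmorphD /= map_polyX map_polyC.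
Qed.

Lemma map_sqr_tail0 i : map_poly (weyl_poly i) (sqr_tail 0) = sqr_tail 0.
Proof.
rewrite rmorph_prod /= -[RHS](@prod_weyl_poly_sqr _ (fun a => 'X - a%:P) i n).
- by apply: eq_bigr => k _; rewrite rmorphB /= map_polyX map_polyC.
- exact: leqnn.
- by case: eqVneq => //= nin; rewrite eq_sym nin.
Qed.

(** Being monic of degree [j], these polynomials make [omega_inv k] equal to [omega k] plus terms in
    later omega_j. *)
Lemma sqr_head_coef j k : (j <= k)%N -> (sqr_head j)`_k = (j == k)%:R.
Proof.
have mon : sqr_head j \is monic.
  by apply: monic_prod => l _; rewrite -[_ ^+ 2]opprK polyCN monicXsubC.
have sz : size (sqr_head j) = j.+1.
  rewrite /sqr_head (eq_bigr (fun l => 'X - (- x l ^+ 2)%:P)) => [|l _].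
    by rewrite size_prod_XsubC size_iota subn0.
  by rewrite polyCN opprK.
case: ltngtP => // [jk|<-] _; first by rewrite nth_default // sz.
by have := monicP mon; rewrite /lead_coef sz.
Qed.

Lemma polyP_Lam (a : {mpoly rat[n]}) :
  (forall i, weyl_poly i a = a) -> polyP a \in Lam_pred n.
Proof. by move=> ha; apply/Lam_predP => i; rewrite weyl_polyP ha. Qed.

Definition omega_inv (k : nat) : Pext n :=
  \sum_(j < n) polyP (sqr_head j)`_k * omega j.

(** For i not last, s_i moves only omega_i and the coefficient of omega_(i+1). Writing h for
    [sqr_head i], that coefficient comes from h(X + x_i^2), which becomes h(X + x_(i+1)^2); the
    extra term h(x_i^2 - x_(i+1)^2) from s_i(omega_i) restores it. *)
Lemma omega_inv_Lam k : omega_inv k \in Lam_pred n.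
Proof.
apply/Lam_predP => i; rewrite raddf_sum /=.
under eq_bigr do rewrite rmorphM /= weyl_polyP weyl_omegaE weyl_omegaD mulrDr -coef_map /=.
have [ein|nin] := eqVneq i.+1 n.
  apply: eq_bigr => j _; rewrite /weyl_coef ein ltnn /= raddf0 mul0r mulr0 addr0.
  by rewrite map_sqr_head ?ein ?eqxx // ltnW.
have lt_in : (i.+1 < n)%N by have := ltn_ord i; lia.
rewrite big_split /= [X in _ + X](bigD1 i) //= [X in _ + (_ + X)]big1 => [|j ji]; last first.
  by rewrite /weyl_coef (negPf ji) andbF raddf0 mul0r mulr0.
rewrite addr0 /omega_inv (bigD1 (ordS i)) //= [RHS](bigD1 (ordS i)) //= addrAC.
congr (_ + _); last first.
  apply: eq_bigr => j; rewrite -val_eqE /= modn_small // => jS.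
  by rewrite map_sqr_head ?(ltnW (ltn_ord j)) // jS orbT.
rewrite mulrA -polyPM -mulrDl -raddfD /=; congr (polyP _ * _).
have map_head : map_poly (weyl_poly i) (sqr_head i) = sqr_head i.
  by apply: map_sqr_head; [exact/ltnW/ltn_ord | lia].
have headS : sqr_head i.+1 = sqr_head i * ('X + (x i ^+ 2)%:P).
  by rewrite /sqr_head big_nat_recr.
rewrite map_head /weyl_coef lt_in eqxx /= modn_small // headS.
rewrite (rmorphM (map_poly (weyl_poly i))) /= map_head rmorphD /=.
rewrite map_polyX map_polyC /= (rmorphXn (weyl_poly i)) /=.
rewrite weyl_poly_xnl //.
rewrite (_ : 'X_i = x i); last by rewrite /xn inord_val.
rewrite (_ : 'X_(ordS i) = x i.+1); last first.
  by congr 'X_ _; apply: val_inj; rewrite /= inordK // modn_small.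
move: (sqr_head i) (x i ^+ 2) (x i.+1 ^+ 2) => h u v.
have coef_mul w : (h * ('X + w%:P))`_k = (h * 'X)`_k + h`_k * w.
  by rewrite mulrDr coefD coefMC.
have aux (c d : {mpoly rat[n]}) : c + d * v + d * (u - v) = c + d * u by ring.
exact: etrans (congr1 (+%R^~ _) (coef_mul v)) (etrans (aux _ _) (esym (coef_mul u))).
Qed.

(** The span over [Lam] of the staircase monomials in x_0, ..., x_(m-1). The last variable is
    outermost, so that coefficient operators can peel the variables off one at a time. *)
Fixpoint staircase m p : Prop :=
  if m is m'.+1 then exists q : nat -> Pext n, (forall j, staircase m' (q j)) /\
    p = \sum_(j < 2 * (n - m')) polyP (x m' ^+ j) * q j
  else p \in Lam_pred n.

Definition subalgebra_pred (P : Pext n -> Prop) :=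
  [/\ forall l, l \in Lam_pred n -> P l,
      forall p q, P p -> P q -> P (p + q)
    & forall p q, P p -> P q -> P (p * q)].

(** * Adjoining one more variable to the staircase span *)

Section Step.
Variable m : nat.
Hypothesis lt_mn : (m < n)%N.
Hypothesis IH : subalgebra_pred (staircase m).
Hypothesis IHcoef : forall k, staircase m (polyP (sqr_tail m)`_k).
Local Notation K := (2 * (n - m))%N.

Lemma staircaseD p q : staircase m.+1 p -> staircase m.+1 q -> staircase m.+1 (p + q).
Proof.
have [_ hD _] := IH => -[r [hr ->]] [r' [hr' ->]].
exists (fun j => r j + r' j); split=> [j|]; first by apply: hD; [apply: hr | apply: hr'].
by rewrite -big_split /=; apply: eq_bigr => j _; rewrite mulrDr.
Qed.

Lemma staircase_sum I (r : seq I) (P : pred I) F :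
  (forall j, P j -> staircase m.+1 (F j)) -> staircase m.+1 (\sum_(j <- r | P j) F j).
Proof.
have [hL _ _] := IH => hF; elim/big_ind: _ => // [|p q]; last exact: staircaseD.
exists (fun=> 0); split=> [j|]; first by apply/hL/rpred0.
by rewrite big1 // => j _; rewrite mulr0.
Qed.

Lemma staircase_term j q : (j < K)%N -> staircase m q ->
  staircase m.+1 (polyP (x m ^+ j) * q).
Proof.
move=> jK hq; exists (fun k => if k == j then q else 0); split=> [k|].
  by case: eqP => // _; have [hL _ _] := IH; apply/hL/rpred0.
rewrite (bigD1 (Ordinal jK)) //= eqxx big1 ?addr0 // => k.
by rewrite -val_eqE /= => /negPf->; rewrite mulr0.
Qed.

Lemma staircase_sub q : staircase m q -> staircase m.+1 q.
Proof.
move=> hq; rewrite -[q]mul1r -(rmorph1 (@polyP n)) -(expr0 (x m)).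
by apply: staircase_term => //; lia.
Qed.

Lemma staircase_mull p q : staircase m p -> staircase m.+1 q -> staircase m.+1 (p * q).
Proof.
move=> hp [r [hr ->]]; have [_ _ hM] := IH.
exists (fun j => p * r j); split=> [j|]; first by apply: hM; last apply: hr.
by rewrite mulr_sumr; apply: eq_bigr => j _; rewrite !mulrA polyP_central.
Qed.

(** [sqr_tail m] is monic of degree n - m and vanishes at x_m^2. *)
Lemma sqr_tail_root : x m ^+ K = - \sum_(k < n - m) (sqr_tail m)`_k * x m ^+ (2 * k).
Proof.
have mon : sqr_tail m \is monic by apply: monic_prod => j _; rewrite monicXsubC.
have sz : size (sqr_tail m) = (n - m).+1 by rewrite size_prod_XsubC size_iota.
have : (sqr_tail m).[x m ^+ 2] = 0.
  by rewrite /sqr_tail big_ltn // hornerM hornerXsubC subrr mul0r.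
rewrite horner_coef sz big_ord_recr /=.
have := monicP mon; rewrite /lead_coef sz /= => ->; rewrite mul1r addrC.
rewrite -exprM => /eqP; rewrite addr_eq0 => /eqP ->; congr (- _).
by apply: eq_bigr => k _; rewrite -exprM.
Qed.

Lemma staircase_mulX j q : staircase m.+1 q -> staircase m.+1 (polyP (x m ^+ j) * q).
Proof.
elim: j => [|j IHj] hq; first by rewrite rmorph1 mul1r.
rewrite exprS polyPM -mulrA; move: (polyP _ * q) (IHj hq) => {q hq IHj}_ [q [hq ->]].
rewrite mulr_sumr; apply: staircase_sum => k _; rewrite mulrA -polyPM -exprS.
have [lt_kK|] := ltnP k.+1 K; first by apply: staircase_term; last apply: hq.
(* Only the top exponent overflows, to exactly [K]; the root relation replaces this power by even
   powers below [K] with coefficients in [staircase m]. *)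
rewrite leq_eqVlt ltnNge ltn_ord orbF => /eqP <-.
rewrite sqr_tail_root raddfN /= mulNr raddf_sum /= mulr_suml -sumrN.
apply: staircase_sum => l _; rewrite -mulrN polyPM -mulrA.
apply: staircase_mull; first exact: IHcoef.
apply: staircase_term; first by have := ltn_ord l; lia.
have [hL _ hM] := IH; rewrite -mulN1r; apply: hM; last exact: hq.
by apply: hL; rewrite rpredN1.
Qed.

Lemma staircase_step_subalgebra : subalgebra_pred (staircase m.+1).
Proof.
have [hL hD hM] := IH; split=> [l hl|p q hp hq|_ q [p [hp ->]] hq].
- exact/staircase_sub/hL.
- exact: staircaseD.
- rewrite mulr_suml; apply: staircase_sum => j _; rewrite -mulrA.
  by apply: staircase_mulX; apply: staircase_mull; first exact: hp.
Qed.

(** Comparing coefficients in [sqr_tail m] = (X - x_m^2) [sqr_tail m.+1] expresses each coefficient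
    through the next one; the recursion starts beyond the degree, where they vanish. *)
Lemma staircase_step_coef k : staircase m.+1 (polyP (sqr_tail m.+1)`_k).
Proof.
have [_ hD hM] := staircase_step_subalgebra.
have [t] := ubnP (size (sqr_tail m.+1) - k); elim: t k => // t IHt k lt_t.
have [le_k|lt_k] := leqP (size (sqr_tail m.+1)) k.
  rewrite nth_default // raddf0; apply: staircase_sub.
  by have [hL _ _] := IH; apply/hL/rpred0.
have -> : (sqr_tail m.+1)`_k = (sqr_tail m)`_k.+1 + x m ^+ 2 * (sqr_tail m.+1)`_k.+1.
  by rewrite {2}/sqr_tail big_ltn // mulrBl coefB coefXM coefCM /= subrK.
rewrite raddfD /=; apply: hD; first exact/staircase_sub/IHcoef.
by rewrite polyPM; apply: staircase_mulX; apply: IHt; lia.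
Qed.

End Step.

(** The first two properties feed each other in the induction, since reducing powers of x_m uses the
    coefficients of [sqr_tail m]. The third puts the variables in the span, and the fourth is the
    invariance that the coefficient operators require. *)
Lemma staircase_props m : (m <= n)%N ->
  [/\ subalgebra_pred (staircase m), forall k, staircase m (polyP (sqr_tail m)`_k),
      forall j, (j < m)%N -> staircase m (polyP (x j))
    & forall p, staircase m p -> invariant_from m p].
Proof.
elim: m => [_|m IHm lt_mn].
  split=> //.
  - by split=> // p q; [apply: rpredD | apply: rpredM].
  - by move=> k; apply: polyP_Lam => i; rewrite -coef_map map_sqr_tail0.
  - by move=> p /Lam_predP hp i _.
have [hS hc hx hi] := IHm (ltnW lt_mn); split.
- exact: staircase_step_subalgebra.
- exact: staircase_step_coef.
- move=> j; rewrite ltnS leq_eqVlt => /orP[/eqP->|/hx]; last exact: staircase_sub.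
  rewrite -[polyP _]mulr1 -[x m]expr1; apply: staircase_term => //; first by lia.
  by have [hL _ _] := hS; apply/hL/rpred1.
- move=> _ [q [hq ->]] i lt_mi; rewrite raddf_sum /=; apply: eq_bigr => j _.
  rewrite rmorphM /= (hi _ (hq j)) ?(ltnW lt_mi) // weyl_polyP rmorphXn /=.
  by rewrite weyl_poly_xn //; lia.
Qed.

Lemma staircase_total p : staircase n p.
Proof.
have [[hL hD hM] _ hx _] := staircase_props (leqnn n).
have hX i : staircase n (polyP 'X_i) by have := hx i (ltn_ord i); rewrite /xn inord_val.
have h1 : staircase n 1 by apply/hL/rpred1.
have h0 : staircase n 0 by apply/hL/rpred0.
have hZ (c : rat) q : staircase n q -> staircase n (c *: q).
  move=> hq; rewrite -[q]mul1r scalerAl; apply: hM => //.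
  by apply: hL; rewrite rpredZ ?rpred1.
have hP a : staircase n (polyP a).
  rewrite (mpolyE a) raddf_sum /=; elim/big_ind: _ => [||m _]; [exact: h0 | exact: hD |].
  rewrite polyPZ; apply: (hZ); rewrite mpolyXE_id rmorph_prod /=.
  elim/big_ind: _ => [||i _]; [exact: h1 | exact: hM |].
  rewrite rmorphXn /=; elim: (m i) => [|k IH]; first by rewrite expr0.
  by rewrite exprS; apply: (hM); first exact: hX.
elim/pext_ind: p => [c p q hp hq||||i] //; first by apply: (hD); first exact: hZ.
(* Downward induction on [i]: the passage from omega_j to [omega_inv] is unitriangular. *)
have [t] := ubnP (n - i); elim: t i => // t IH i lt_t.
rewrite (_ : omega i = omega_inv i - \sum_(j < n | (i < j)%N) polyP (sqr_head j)`_i * omega j).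
  apply: (hD); first exact/hL/omega_inv_Lam.
  rewrite -scaleN1r; apply: (hZ); elim/big_ind: _ => [||j ij]; [exact: h0 | exact: hD |].
  by apply: (hM); [exact: hP | apply: (IH); have := ltn_ord j; lia].
rewrite /omega_inv (bigID (fun j : 'I_n => (i < j)%N)) /= addrAC subrr add0r.
rewrite (bigD1 i) ?ltnn //= sqr_head_coef // eqxx rmorph1 mul1r big1 ?addr0 // => j.
rewrite -leqNgt => /andP[ji nji].
by rewrite sqr_head_coef // (negPf nji : (j == i :> nat) = false) raddf0 mul0r.
Qed.

End Spanning.

(** * Dual bases *)

(** [P] is a free right [Lam]-module on [b], with coordinate functions [D] lying in NH. The degree
    of a basis element is stated for its multiplication operator, so that [op_degree] covers every
    Weyl-compatible grading. *)
Record dual_bases n (P : Pext n -> Prop) (I : finType) (deg : I -> nat)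
    (b : I -> Pext n) (D : I -> linop n) : Prop := DualBases {
  dual_basis_degree : forall i, op_degree (deg i)%:Z (lmul_op (b i));
  dual_coord_NH : forall i, in_NH (D i);
  dual_coord_degree : forall i, op_degree (- (deg i)%:Z) (D i);
  dual_basis_mem : forall i l, l \in Lam_pred n -> P (b i * l);
  dual_coord_Lam : forall i p, P p -> D i p \in Lam_pred n;
  dual_decomp : forall p, P p -> p = \sum_i b i * D i p;
  dual_coordE : forall i j l, l \in Lam_pred n ->
    D i (b j * l) = if i == j then l else 0 }.

(** Each step takes the products x_m^j b_i, with coordinates [D i * C j]. The index type is
    existential because it becomes a product at each step; the generating polynomial keeps track of
    the degrees. *)
Lemma staircase_dual_bases n' m : (m <= n'.+1)%N ->
  exists (I : finType) (deg : I -> nat) (b : I -> Pext n'.+1) (D : I -> linop n'.+1),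
    dual_bases (staircase m) deg b D /\
    \sum_i 'X^(deg i) =
      \prod_(k < m) \sum_(j < 2 * (n'.+1 - k)) 'X^j :> {poly nat}.
Proof.
elim: m => [_|m IH lt_mn].
  exists unit, (fun=> 0%N), (fun=> 1), (fun=> 1); split; last first.
    by rewrite big_ord0 (big_pred1 tt) // => -[].
  split=> // [i|i|i|i l|p _|[] []] //=.
  - by move=> Z u w _ y p; rewrite mulr0z addr0 [lmul_op _ _]/= mul1r.
  - exact: in_NH1.
  - exact: op_degree1.
  - by rewrite mul1r.
  - by rewrite (big_pred1 tt) ?mul1r // => -[].
  - by move=> l _; rewrite mul1r.
have [I [deg [b [D [[degb NHD degD memb LamD decD dualD] sumdeg]]]]] := IH (ltnW lt_mn).
have [_ _ _ inv_m] := staircase_props (ltnW lt_mn).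
set K := (2 * (n'.+1 - m))%N.
have /choice[C hC] (j : 'I_K) := coef_operator lt_mn (ltn_ord j).
have eC1 (j k : 'I_K) p : staircase m p ->
    C j (polyP (xn n' m ^+ k) * p) = if k == j then p else 0.
  by move=> hp; have [_ _ ->] := hC j; [|exact: ltn_ord | exact: inv_m].
have eC (j : 'I_K) (q : nat -> Pext n'.+1) : (forall k, staircase m (q k)) ->
    C j (\sum_(k < K) polyP (xn n' m ^+ k) * q k) = q j.
  move=> hq; rewrite raddf_sum (bigD1 j) //= eC1 // eqxx big1 ?addr0 // => k kj.
  by rewrite eC1 // (negPf kj).
exists (I * 'I_K)%type, (fun ij : I * 'I_K => ij.2 + deg ij.1)%N,
  (fun ij : I * 'I_K => polyP (xn n' m ^+ ij.2) * b ij.1),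
  (fun ij : I * 'I_K => D ij.1 * C ij.2).
split; last first.
  rewrite big_ord_recr /= -sumdeg big_distrlr pair_bigA /=.
  by apply: eq_bigr => -[i j] _ /=; rewrite addnC exprD.
split=> [[i j]|[i j]|[i j]|[i j] l hl|[i j] _ [q [hq ->]]|_ [q [hq ->]]|[i j] [i' j'] l hl] /=.
- rewrite PoszD (_ : lmul_op _ = lmul_op (polyP (xn n' m ^+ j)) * lmul_op (b i)).
    by apply: op_degreeM => //; apply: op_degree_lmulXn.
  by apply: linopP => p; rewrite /= mulrA.
- by apply: in_NH_comp => //; have [] := hC j.
- rewrite PoszD opprD addrC; apply: op_degreeM => //.
  by have [] := hC j.
- rewrite -mulrA; exists (fun k : nat => if k == j :> nat then b i * l else 0); split=> [k|].
    case: eqP => _; first exact: memb.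
    have [[hL _ _] _ _ _] := staircase_props (ltnW lt_mn).
    exact/hL/rpred0.
  rewrite (bigD1 j) //= eqxx big1 ?addr0 // => k.
  by rewrite -val_eqE => /negPf /= ->; rewrite mulr0.
- by rewrite eC //; apply: LamD; apply: hq.
- rewrite -[RHS](pair_bigA _ (fun (i : I) (j : 'I_K) => polyP (xn n' m ^+ j) * b i *
    D i (C j (\sum_(k < K) polyP (xn n' m ^+ k) * q k)))) /=.
  rewrite exchange_big /=; apply: eq_bigr => j _; rewrite {1}(decD _ (hq j)) mulr_sumr.
  by apply: eq_bigr => i _; rewrite eC // mulrA.
- rewrite -mulrA eC1; last exact: memb.
  rewrite xpair_eqE (eq_sym j') andbC; case: (j == j'); last by rewrite raddf0.
  exact: dualD.
Qed.

Lemma perm_map_lift (T U : eqType) (f : T -> U) (s : seq T) (t : seq U) :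
  perm_eq (map f s) t -> exists2 r, perm_eq r s & t = map f r.
Proof.
elim: t s => [|k t IH] s pst.
  by exists [::] => //; case: s pst => // x s /perm_size.
have /mapP[x xs ek] : k \in map f s by rewrite (perm_mem pst) mem_head.
have px := perm_to_rem xs.
move: pst; rewrite (permPl (perm_map f px)) /= -ek perm_cons => /IH[r pr ->].
by exists (x :: r); rewrite /= -?ek // perm_sym (permPl px) perm_cons perm_sym.
Qed.

(** Coefficients of the generating polynomial count multiplicities, so the degrees are a permutation
    of [exponents]; lifting it to [I] gives the enumeration. *)
Lemma poincareB_exponents n (I : finType) (deg : I -> nat) :
  \sum_i 'X^(deg i) = poincareB n ->
  exists g : 'I_((poincareB n).[1]) -> I, bijective g /\
    forall i, deg (g i) = basis_deg i.
Proof.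
move=> sumdeg; set P := poincareB n in sumdeg *.
have countE (s : seq nat) k : (\sum_(e <- s) 'X^e : {poly nat})`_k = count_mem k s.
  rewrite coef_sum -sum1_count [RHS]big_mkcond; apply: eq_bigr => e _ /=.
  by rewrite coefXn eq_sym; case: eqP.
have perm_deg : perm_eq [seq deg i | i <- enum I] (exponents P).
  apply/allP => k _ /=; rewrite -!countE exponentsE -sumdeg.
  by rewrite big_map big_enum.
have [r perm_r deg_r] : exists2 r : seq I, perm_eq r (enum I) & exponents P = [seq deg i | i <- r].
  exact: perm_map_lift.
have sz : size r = P.[1] by rewrite -size_exponents deg_r size_map.
pose g (i : 'I_(P.[1])) := tnth (in_tuple r) (cast_ord (esym sz) i).
exists g; split=> [|i]; last first.
  rewrite /g /basis_deg /= deg_r (tnth_nth (g i)) /= (nth_map (g i)) //.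
  by rewrite sz.
have ur : uniq r by rewrite (perm_uniq perm_r) enum_uniq.
apply: inj_card_bij => [i j /eqP|].
  rewrite /g; set x0 := g i; rewrite !(tnth_nth x0) /= nth_uniq ?sz // => /eqP ij.
  exact: val_inj.
by rewrite card_ord -sz (perm_size perm_r) cardE.
Qed.

(** * The isomorphisms *)

Lemma poincareB_dual_bases n : (0 < n)%N ->
  exists (b : 'I_((poincareB n).[1]) -> Pext n) (D : 'I_((poincareB n).[1]) -> linop n),
    dual_bases (fun=> True) (@basis_deg (poincareB n)) b D.
Proof.
case: n => // n' _.
have [I [deg [b [D [[degb NHD degD memb LamD decD dualD] sumdeg]]]]] :=
  @staircase_dual_bases n' n'.+1 (leqnn _).
have [|g [bij_g deg_g]] := @poincareB_exponents n'.+1 I deg.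
  (* The factor of x_k has 2(n - k) terms, so the order of the factors is reversed. *)
  rewrite sumdeg /poincareB (reindex_inj rev_ord_inj) /=.
  by apply: eq_bigr => i _; rewrite subKn.
exists (b \o g), (D \o g); split=> /=.
- by move=> i; rewrite -deg_g.
- by [].
- by move=> i; rewrite -deg_g.
- by [].
- by move=> i p _; apply: LamD; apply: staircase_total.
- move=> p _; rewrite {1}(decD p (staircase_total p)).
  by rewrite (reindex g) //; apply: onW_bij.
- by move=> i j l hl; rewrite dualD // (bij_eq bij_g).
Qed.

(** * Endomorphisms as matrices in a dual pair of bases *)

Section MatrixModel.
Variables (n N : nat) (deg : 'I_N -> nat) (b : 'I_N -> Pext n) (D : 'I_N -> linop n).
Hypothesis bD : dual_bases (fun=> True) deg b D.

Lemma coord_Lam i p : D i p \in Lam_pred n.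
Proof. exact: dual_coord_Lam bD _ _ I. Qed.

Definition coord i p : Lam n := MkLam (coord_Lam i p).

Lemma coord_rlinear i p (l : Lam n) : D i (p * (l : Pext n)) = D i p * (l : Pext n).
Proof. exact: (NH_rlinear (dual_coord_NH bD i)) (valP l). Qed.

Lemma coord_basis i j : D i (b j) = (i == j)%:R.
Proof. by rewrite -[b j]mulr1 (dual_coordE bD) ?rpred1 //; case: eqP. Qed.

Lemma EndLam_expand f p : f \in EndLam_pred n -> f p = \sum_j f (b j) * D j p.
Proof.
move=> /EndLam_rlinear rf; rewrite {1}(dual_decomp bD (p := p)) // raddf_sum.
by apply: eq_bigr => j _; rewrite /= rf // coord_Lam.
Qed.

(** By right linearity [f] is the sum of the operators p |-> f(b_j) D_j(p), each built from a
    multiplication and a coordinate function. *)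
Lemma EndLam_sub_NH f : f \in EndLam_pred n -> in_NH f.
Proof.
move=> hf; have -> : f = \sum_j lmul_op (f (b j)) * D j.
  by apply: linopP => p; rewrite linop_sumE (EndLam_expand p hf).
apply: in_NH_sum => j _; apply: in_NH_comp; first exact: in_NH_mul.
exact: dual_coord_NH bD j.
Qed.

Definition mx_of_End (f : EndLam n) : 'M[Lam n]_N := \matrix_(i, j) coord i (f (b j)).

Lemma mx_of_EndE f i j : (mx_of_End f i j : Pext n) = D i (f (b j)).
Proof. by rewrite mxE. Qed.

Lemma mx_of_End_is_additive : {morph mx_of_End : f g / f - g}.
Proof.
move=> f g; apply/matrixP => i j; apply: val_inj.
by rewrite [RHS]/= !mxE /= -raddfB.
Qed.

(** Expanding g(b_j) in the basis leaves its coordinates on the right, where right linearity takes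
    them out in the order of the matrix product; [Lam] need not commute. *)
Lemma mx_of_End_is_monoid_morphism : monoid_morphism mx_of_End.
Proof.
split=> [|f g]; apply/matrixP => i j; apply: val_inj.
  by rewrite [LHS]mx_of_EndE mxE [LHS]coord_basis; case: eqP.
rewrite [LHS]mx_of_EndE mxE raddf_sum /=.
rewrite [f (g (b j))](EndLam_expand _ (valP f)) raddf_sum /=.
apply: eq_bigr => k _; rewrite !mx_of_EndE.
by rewrite -[D k _]/(val (coord k (g (b j)))) coord_rlinear.
Qed.

HB.instance Definition _ :=
  GRing.isZmodMorphism.Build (EndLam n) 'M[Lam n]_N mx_of_End mx_of_End_is_additive.
HB.instance Definition _ :=
  GRing.isMonoidMorphism.Build (EndLam n) 'M[Lam n]_N mx_of_End mx_of_End_is_monoid_morphism.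

Lemma mx_of_EndZ c f : mx_of_End (c *: f) = (c *: 1 : Lam n) *: mx_of_End f.
Proof.
apply/matrixP => i j; apply: val_inj; rewrite [LHS]mx_of_EndE mxE /=.
by rewrite linearZ /= -scalerAl mul1r mx_of_EndE.
Qed.

Definition op_of_mx (M : 'M[Lam n]_N) : linop n :=
  \sum_i \sum_j lmul_op (b i) * (lmul_op (M i j : Pext n) * D j).

Lemma op_of_mxK f : op_of_mx (mx_of_End f) = f.
Proof.
apply: linopP => p; rewrite (EndLam_expand p (valP f)) /op_of_mx linop_sumE.
under eq_bigr do rewrite linop_sumE.
rewrite exchange_big /=; apply: eq_bigr => j _.
rewrite (dual_decomp bD (p := f (b j))) // mulr_suml.
by apply: eq_bigr => i _; rewrite mx_of_EndE mulrA.
Qed.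

Lemma op_of_mx_NH M : in_NH (op_of_mx M).
Proof.
apply: in_NH_sum => i _; apply: in_NH_sum => j _.
apply: in_NH_comp; first exact: in_NH_mul.
by apply: in_NH_comp; [exact: in_NH_mul | apply: dual_coord_NH bD j].
Qed.

Definition End_of_mx M : EndLam n := MkEndLam (NH_sub_EndLam (op_of_mx_NH M)).

Lemma op_of_mx_basis M j : op_of_mx M (b j) = \sum_i b i * (M i j : Pext n).
Proof.
rewrite /op_of_mx linop_sumE; apply: eq_bigr => i _.
rewrite linop_sumE (bigD1 j) //= big1 => [|k kj].
  by rewrite coord_basis eqxx mulr1 addr0.
by rewrite coord_basis (negPf kj) !mulr0.
Qed.

Lemma mx_of_End_bij : bijective mx_of_End.
Proof.
exists End_of_mx => [f|M]; first by apply: val_inj; apply: op_of_mxK.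
apply/matrixP => i j; apply: val_inj; rewrite [LHS]mx_of_EndE [End_of_mx M _]op_of_mx_basis.
rewrite raddf_sum (bigD1 i) //= big1 => [|k ki].
  by rewrite coord_rlinear coord_basis eqxx mul1r addr0.
by rewrite coord_rlinear coord_basis eq_sym (negPf ki) mul0r.
Qed.

Section Grading.
Variables (Z : zmodType) (u : Z) (w : 'I_n -> Z).
Hypothesis uw : weyl_grading u w.

(** One direction reads degrees from f = sum b_i M_ij D_j, the other from M_ij = D_i(f(b_j)). *)
Lemma op_graded_mx_of_End z f :
  (forall i j, graded u w (z + u *~ (deg j)%:Z - u *~ (deg i)%:Z) (mx_of_End f i j)) <->
  op_graded u w z f.
Proof.
split=> [gM|gf i j].
  rewrite -(op_of_mxK f); apply: op_graded_sum => i _; apply: op_graded_sum => j _.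
  rewrite (_ : z = u *~ (deg i)%:Z + (z + u *~ (deg j)%:Z - u *~ (deg i)%:Z + u *~ (- (deg j)%:Z))).
    apply: op_gradedM; first by apply: dual_basis_degree bD _ _ _ _ uw.
    apply: op_gradedM; first exact: op_graded_lmul.
    by apply: dual_coord_degree bD _ _ _ _ uw.
  by rewrite mulrNz addrAC addrK addrCA subrr addr0.
have gD : op_graded u w (u *~ - (deg i)%:Z) (D i) := dual_coord_degree bD uw.
have gb : op_graded u w (u *~ (deg j)%:Z) (lmul_op (b j)) := dual_basis_degree bD uw.
rewrite mx_of_EndE -mulrNz; apply: gD; rewrite addrC; apply: gf.
(* The weight of [b j] is obtained by applying its multiplication operator to 1, which has weight
   0. *)
by rewrite -[b j]mulr1 -[u *~ _]add0r; apply: gb; apply: graded1.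
Qed.

End Grading.

End MatrixModel.

(** * The action map from NH to the endomorphism algebra *)

Section Action.
Variable n : nat.

Definition NH_action (a : NH n) : EndLam n := MkEndLam (NH_sub_EndLam (asboolW (valP a))).

Lemma NH_action_is_linear : linear NH_action.
Proof. by move=> c a a'; apply: val_inj. Qed.

Lemma NH_action_is_monoid_morphism : monoid_morphism NH_action.
Proof. by split=> [|a a']; apply: val_inj. Qed.

HB.instance Definition _ :=
  GRing.isLinear.Build rat (NH n) (EndLam n) _ NH_action NH_action_is_linear.
HB.instance Definition _ :=
  GRing.isMonoidMorphism.Build (NH n) (EndLam n) NH_action NH_action_is_monoid_morphism.

End Action.

Theorem proposition4 (n : nat) (n_gt0 : (0 < n)%N) :
  (exists phi : {lrmorphism NH n -> EndLam n},
    [/\ forall (a : NH n) (p : Pext n), phi a p = a p,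
        bijective phi,
        forall (d : int) (a : NH n), op_homog d (phi a) <-> op_homog d a
      & forall (e : bool) (a : NH n), op_parity e (phi a) <-> op_parity e a])
  /\
  (exists psi : {rmorphism EndLam n -> Mat (poincareB n) (Lam n)},
    [/\ bijective psi,
        forall (c : rat) (f : EndLam n), psi (c *: f) = (c *: 1 : Lam n) *: psi f,
        forall (d : int) (f : EndLam n), mat_homog d (psi f) <-> op_homog d f
      & forall (e : bool) (f : EndLam n), mat_parity e (psi f) <-> op_parity e f]).
Proof.
have [b [D bD]] := poincareB_dual_bases n_gt0; split.
  (* The action leaves the underlying operator unchanged, so only surjectivity needs an argument. *)
  exists (NH_action (n := n)); split=> //.
  have End_NH (f : EndLam n) : val f \in NH_pred n.
    exact/asboolP/(EndLam_sub_NH bD)/valP.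
  by exists (fun f => MkNH (End_NH f)) => [a|f]; apply: val_inj.
exists (mx_of_End bD); split.
- exact: mx_of_End_bij.
- exact: mx_of_EndZ.
- move=> d f; rewrite op_homog_graded -(op_graded_mx_of_End bD (@omega_deg_weyl n)).
  by split=> h i j; have := h i j; rewrite !intz homog_graded.
(* For the parity [u] is 0, so the basis is even and the degree shifts disappear. *)
- move=> e f; rewrite op_parity_graded -(op_graded_mx_of_End bD (@parity_weyl_grading n)).
  by split=> h i j; have := h i j; rewrite !mul0rz subr0 addr0 parity_graded.
Qed.
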